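(* Let $\ell\ge1$ be an integer, and for each integer $m\ge1$ let $r^{(2)}:\mathcal{J}^{(2)}_{2\ell}(m)\to\mathcal{J}^{(2)}_{2\ell}(m-1)$ be the restriction map on universal symmetric $2$-tensor valued curvature invariants. Then: 1. $r^{(2)}:\mathcal{J}^{(2)}_{2\ell}(m)\to\mathcal{J}^{(2)}_{2\ell}(m-1)$ is surjective for any $m$. 2. If $m>2\ell+1$, then $r^{(2)}:\mathcal{J}^{(2)}_{2\ell}(m)\to\mathcal{J}^{(2)}_{2\ell}(m-1)$ is injective. 3. If $m=2\ell+1$, then $\ker\{r^{(2)}:\mathcal{J}^{(2)}_{2\ell}(m)\to\mathcal{J}^{(2)}_{2\ell}(m-1)\}=\operatorname{Span}\{T^{(2)}_{2\ell,m}\}$.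
   Context: An inner product space $(V,\varepsilon)$ of signature $(p,q)$ is a real vector space $V$ of dimension $m=p+q$ with a non-degenerate symmetric bilinear form $\varepsilon$ with $p$ negative and $q$ positive directions. $\varepsilon^*$ denotes the dual inner product on $V^*$. $\mathfrak{A}(V)\subset\otimes^4(V^* )$ is the space of algebraic curvature tensors: those $A$ such that for all $x,y,z,w\in V$, $A(x,y,z,w)=-A(y,x,z,w)=A(z,w,x,y)$ and $A(x,y,z,w)+A(y,z,x,w)+A(z,x,y,w)=0$. $\operatorname{Perm}(4\ell)$ is the group of permutations of $\{1,\dots,4\ell\}$, $\sigma_i=\sigma(i)$; $x\circ y=\frac12(x\otimes y+y\otimes x)$. Let $\{e_i\}$ be a basis of $V$ with dual basis $\{e^i\}$, $\varepsilon^{ij}$ the inverse matrix of $\varepsilon_{ij}=\varepsilon(e_i,e_j)$, and sum over repeated indices. For $A\in\mathfrak{A}(V)$ put $\eta_{i_1\dots i_{4\ell}}=A_{i_1i_2i_3i_4}\cdots A_{i_{4\ell-3}i_{4\ell-2}i_{4\ell-1}i_{4\ell}}$ and $$P^{(2)}_{2\ell,1,\sigma,\varepsilon}(A)=\varepsilon^{i_1i_2}\cdots\varepsilon^{i_{4\ell-3}i_{4\ell-2}}\,\eta_{i_{\sigma_1}\dots i_{\sigma_{4\ell}}}\,e^{i_{4\ell-1}}\circ e^{i_{4\ell}},\qquad P^{(2)}_{2\ell,2,\sigma,\varepsilon}(A)=\varepsilon^{i_1i_2}\cdots\varepsilon^{i_{4\ell-1}i_{4\ell}}\,\eta_{i_{\sigma_1}\dots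 i_{\sigma_{4\ell}}}\,\varepsilon .$$ For real constants $\mathcal{D}=\{d^{(2)}_{1,\sigma},d^{(2)}_{2,\sigma}\}_{\sigma}$ put $P^{(2)}_{2\ell,\mathcal{D},\varepsilon}=\sum_\sigma\{d^{(2)}_{1,\sigma}P^{(2)}_{2\ell,1,\sigma,\varepsilon}+d^{(2)}_{2,\sigma}P^{(2)}_{2\ell,2,\sigma,\varepsilon}\}$, a function $\mathfrak{A}(V)\to S^2(V^* )$. $\mathcal{J}^{(2)}_{2\ell}(m)$ is the real vector space of families $P=\{P_\varepsilon\}$ of functions $P_\varepsilon:\mathfrak{A}(V)\to S^2(V^* )$, one for each inner product space $(V,\varepsilon)$ of dimension $m$ (of any signature), for which there is a collection $\mathcal{D}$ with $P_\varepsilon=P^{(2)}_{2\ell,\mathcal{D},\varepsilon}$ for all such $(V,\varepsilon)$; families are equal when equal as functions. (For any one fixed $(V,\varepsilon)$ of dimension $m$, $P\mapsto P_\varepsilon$ identifies $\mathcal{J}^{(2)}_{2\ell}(m)$ with the space of $S^2(V^* )$-valued polynomials on $\mathfrak{A}(V)$, homogeneous of degree $\ell$, that are equivariant under the orthogonal group of $\varepsilon$.) In dimension $0$, $\mathcal{J}^{(2)}_{2\ell}(0)=0$. The restriction map $r^{(2)}$ is defined geometrically by $\{r^{(2)}(P)\}(N,g_N)(\xi)=i_N^*\{P(N\times S^1,g_N\pm d\theta^2)(\xi,\theta_1)\}$, where $(N,g_N)$ is a pseudo-Riemannian manifold of dimension $m-1$, $\xi\in N$, $\theta_1\in S^1$,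 $i_N^*$ is pullback under the inclusion $N\to N\times\{\theta_1\}\subset N\times S^1$, and $P(M,g)(x)$ means $P$ evaluated on the curvature tensor of the Levi-Civita connection at $x$. Equivalently: given $(V,\varepsilon)$ of dimension $m-1$ and $A\in\mathfrak{A}(V)$, let $V'=V\oplus\mathbb{R}f$, with $\varepsilon'|_V=\varepsilon$, $f\perp V$, $\varepsilon'(f,f)=\pm1$, and let $A'\in\mathfrak{A}(V')$ be the extension of $A$ with $A'=0$ whenever one argument is $f$; then $r^{(2)}(P)_\varepsilon(A)=P_{\varepsilon'}(A')|_{V\times V}$. The choice of sign does not matter. $T^{(2)}_{2\ell,m}\in\mathcal{J}^{(2)}_{2\ell}(m)$ is given by $$T^{(2)}_{2\ell,m,\varepsilon}(A)=\sum_{i_1,\dots,i_{2\ell+1},j_1,\dots,j_{2\ell+1}=1}^{m}A_{i_1i_2j_2j_1}\cdots A_{i_{2\ell-1}i_{2\ell}j_{2\ell}j_{2\ell-1}}\ \varepsilon^*(e^{i_1}\wedge\cdots\wedge e^{i_{2\ell+1}},e^{j_1}\wedge\cdots\wedge e^{j_{2\ell+1}})\ e^\flat_{i_{2\ell+1}}\circ e^\flat_{j_{2\ell+1}},$$ where $e_i^\flat=\varepsilon(e_i,\cdot)=\varepsilon_{ik}e^k\in V^*$ and $\varepsilon^*(e^{i_1}\wedge\cdots\wedge e^{i_{k}},e^{j_1}\wedge\cdots\wedge e^{j_{k}})=\det\big(\varepsilon^*(e^{i_a},e^{j_b})\big)_{a,b=1}^{k}$. *)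

(* Defs.v *)
From HB Require Import structures.
From mathcomp Require Import all_boot all_order all_algebra all_fingroup.
From mathcomp Require Import sesquilinear reals ring.

Set Implicit Arguments.
Unset Strict Implicit.
Unset Printing Implicit Defensive.

Import GRing.Theory.
Local Open Scope ring_scope.

(* A non-degenerate symmetric bilinear form on a real vector space has some
   signature (p, q) with p + q = m (Sylvester), and every signature occurs, so
   the type below collects the inner product spaces of dimension m of all
   signatures. *)
Record innerProductSpace (R : realType) (m : nat) := InnerProductSpace {
  ips_vect :> vectType R;
  ips_dim : \dim {:ips_vect} = m;
  ips_form : {symmetric ips_vect};
  ips_nondeg : nondegenerate ips_form
}.

Record curvTensor (R : realType) (V : vectType R) := CurvTensor {
  curv_fun :> V -> V -> V -> V -> R;
  curv_lin1 : forall y z w, scalar (fun x => curv_fun x y z w);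
  curv_lin2 : forall x z w, scalar (fun y => curv_fun x y z w);
  curv_lin3 : forall x y w, scalar (fun z => curv_fun x y z w);
  curv_lin4 : forall x y z, scalar (fun w => curv_fun x y z w);
  curv_anti : forall x y z w, curv_fun x y z w = - curv_fun y x z w;
  curv_pair : forall x y z w, curv_fun x y z w = curv_fun z w x y;
  curv_bianchi : forall x y z w,
    curv_fun x y z w + curv_fun y z x w + curv_fun z x y w = 0
}.

(* The values are functions V -> V -> R. That they lie in S^2(V^* ) is not part
   of this type; it holds for the families in [inJ], see [inJ_sym] and
   [inJ_scalar]. *)
Definition invFamily (R : realType) (m : nat) :=
  forall E : innerProductSpace R m, curvTensor E -> E -> E -> R.

Definition fam_eq (R : realType) (m : nat) (P Q : invFamily R m) : Prop :=
  forall (E : innerProductSpace R m) (A : curvTensor E) (x y : E),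
    P E A x y = Q E A x y.

Definition fam0 (R : realType) (m : nat) : invFamily R m := fun _ _ _ _ => 0.

Definition fam_scale (R : realType) (m : nat) (c : R) (P : invFamily R m) :
  invFamily R m := fun E A x y => c * P E A x y.

(* All contractions are written in the basis [vbasis]; none of them depends on
   the choice of the basis. *)
Section Coordinates.
Variables (R : realType) (m : nat) (E : innerProductSpace R m).
Local Notation I := 'I_(\dim {:E}).

Definition bvec (i : I) : E := (vbasis {:E})`_i.

Definition bcovec (i : I) (x : E) : R := coord (vbasis {:E}) i x.

(* [ginv i j] is also the dual inner product of [bcovec i] and [bcovec j]. *)
Definition ginv (i j : I) : R :=
  invmx (\matrix_(a, b) ips_form E (bvec a) (bvec b)) i j.

Definition flat (u v : E) : R := ips_form E u v.

Definition symprod (phi psi : E -> R) (x y : E) : R :=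
  2^-1 * (phi x * psi y + psi x * phi y).

End Coordinates.

Fact pos2_subproof (l : nat) (k : 'I_(2 * l)) (a : 'I_2) : (2 * k + a < 4 * l)%N.
Proof.
have -> : (4 * l = 2 * (2 * l))%N by rewrite mulnA.
apply: (@leq_trans (2 * k.+1)); last by rewrite leq_mul2l /= ltn_ord.
by rewrite mulnS addnC ltn_add2r.
Qed.

Fact pos4_subproof (l : nat) (k : 'I_l) (a : 'I_4) : (4 * k + a < 4 * l)%N.
Proof.
apply: (@leq_trans (4 * k.+1)); last by rewrite leq_mul2l /= ltn_ord.
by rewrite mulnS addnC ltn_add2r.
Qed.

(* Positions are counted from 0: the k-th pair consists of 2k, 2k+1 and the
   k-th quadruple of 4k, ..., 4k+3. *)
Definition pos2 (l : nat) (k : 'I_(2 * l)) (a : 'I_2) : 'I_(4 * l) :=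
  Ordinal (pos2_subproof k a).

Definition pos4 (l : nat) (k : 'I_l) (a : 'I_4) : 'I_(4 * l) :=
  Ordinal (pos4_subproof k a).

Section Invariants.
Variables (R : realType) (l m : nat).

Definition eta (E : innerProductSpace R m) (A : curvTensor E)
    (i : 'I_(4 * l) -> 'I_(\dim {:E})) : R :=
  \prod_(k < l) A (bvec (i (pos4 k (inord 0)))) (bvec (i (pos4 k (inord 1))))
                  (bvec (i (pos4 k (inord 2)))) (bvec (i (pos4 k (inord 3)))).

(* The first 2l - 1 pairs of indices are contracted; the last pair is the one
   carrying the covectors. *)
Definition Pcontr1 (sigma : 'S_(4 * l)) : invFamily R m := fun E A x y =>
  \sum_(i : {ffun 'I_(4 * l) -> 'I_(\dim {:E})})
    (\prod_(k < 2 * l)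
       let a := i (pos2 k (inord 0)) in
       let b := i (pos2 k (inord 1)) in
       if (k.+1 < 2 * l)%N then ginv a b
       else symprod (bcovec a) (bcovec b) x y)
    * eta A (i \o sigma).

Definition Pcontr2 (sigma : 'S_(4 * l)) : invFamily R m := fun E A x y =>
  (\sum_(i : {ffun 'I_(4 * l) -> 'I_(\dim {:E})})
    (\prod_(k < 2 * l) ginv (i (pos2 k (inord 0))) (i (pos2 k (inord 1))))
    * eta A (i \o sigma))
  * ips_form E x y.

Definition PD (d1 d2 : 'S_(4 * l) -> R) : invFamily R m := fun E A x y =>
  \sum_(sigma : 'S_(4 * l))
    (d1 sigma * Pcontr1 sigma A x y + d2 sigma * Pcontr2 sigma A x y).

Definition inJ (P : invFamily R m) : Prop :=
  exists d1 d2 : 'S_(4 * l) -> R, fam_eq P (PD d1 d2).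

(* i_1, ..., i_(2l+1) are i 0, ..., i (2l); the k-th factor below is thus
   A_(i_(2k+1) i_(2k+2) j_(2k+2) j_(2k+1)). *)
Definition Tinv : invFamily R m := fun E A x y =>
  \sum_(i : {ffun 'I_(2 * l).+1 -> 'I_(\dim {:E})})
  \sum_(j : {ffun 'I_(2 * l).+1 -> 'I_(\dim {:E})})
    (\prod_(k < l) A (bvec (i (inord (2 * k)))) (bvec (i (inord (2 * k).+1)))
                     (bvec (j (inord (2 * k).+1))) (bvec (j (inord (2 * k)))))
    * \det (\matrix_(a, b) ginv (i a) (j b))
    * symprod (flat (bvec (i ord_max))) (flat (bvec (j ord_max))) x y.

Lemma inJ_sym (P : invFamily R m) (E : innerProductSpace R m) (A : curvTensor E)
  (x y : E) : inJ P -> P E A x y = P E A y x.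
Proof.
case=> d1 [d2 PE]; rewrite !PE; apply: eq_bigr => s _; congr (_ * _ + _ * _).
  apply: eq_bigr => i _; congr (_ * _); apply: eq_bigr => k _ /=.
  case: ifP => // _; rewrite /symprod addrC; congr (_ * (_ + _)); exact: mulrC.
congr (_ * _); have := hermitian_subproof (s := ips_form E) x y.
by rewrite /= expr0 mul1r.
Qed.

Lemma inJ_scalar (P : invFamily R m) (E : innerProductSpace R m) (A : curvTensor E)
  (x : E) : (0 < l)%N -> inJ P -> scalar (P E A x).
Proof.
move=> l_gt0 [d1 [d2 PE]] a u v; rewrite !PE /PD mulr_sumr -big_split /=.
apply: eq_bigr => s _.
suff [-> ->] : Pcontr1 s A x (a *: u + v)
      = a * Pcontr1 s A x u + Pcontr1 s A x v
    /\ Pcontr2 s A x (a *: u + v) = a * Pcontr2 s A x u + Pcontr2 s A x v.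
  by ring.
split; last by rewrite /Pcontr2 linearP /= mulrDr mulrCA.
rewrite /Pcontr1 mulr_sumr -big_split /=; apply: eq_bigr => i _.
have lt2 : ((2 * l).-1 < 2 * l)%N by rewrite prednK ?muln_gt0.
have lastF (k : 'I_(2 * l)) : k != Ordinal lt2 -> (k.+1 < 2 * l)%N.
  move=> kN; rewrite ltn_neqAle ltn_ord andbT; apply: contraNneq kN => kE.
  by apply/eqP/val_inj; rewrite /= -[in RHS]kE.
have big z : \prod_(k < 2 * l)
       (if (k.+1 < 2 * l)%N
        then ginv (i (pos2 k (inord 0))) (i (pos2 k (inord 1)))
        else symprod (bcovec (i (pos2 k (inord 0))))
                     (bcovec (i (pos2 k (inord 1)))) x z)
   = symprod (bcovec (i (pos2 (Ordinal lt2) (inord 0))))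
             (bcovec (i (pos2 (Ordinal lt2) (inord 1)))) x z *
     \prod_(k < 2 * l | k != Ordinal lt2)
        ginv (i (pos2 k (inord 0))) (i (pos2 k (inord 1))).
  rewrite (bigD1 (Ordinal lt2)) //= prednK ?muln_gt0 // ltnn; congr (_ * _).
  by apply: eq_bigr => k /lastF ->.
rewrite !big /symprod /bcovec !linearP /=.
by ring.
Qed.

End Invariants.

(* The orthogonal sum V + R f, where f = (0, 1) has square (-1) ^+ s. *)
Section Extension.
Variables (R : realType) (s : bool).

Definition ext_form (V : vectType R) (g : {symmetric V}) (u v : V * R^o) : R :=
  g u.1 v.1 + (-1) ^+ s * (u.2 * v.2).

Fact ext_form_bilinear (V : vectType R) (g : {symmetric V}) :
  bilinear_for
    (GRing.Scale.Law.clone _ _ ( *%R ) _)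
    (GRing.Scale.Law.clone _ _ (idfun \; *%R ) _) (ext_form g).
Proof.
have algl (t a b c p q r : R) :
    a * b + c + t * ((a * p + q) * r) = a * (b + t * (p * r)) + (c + t * (q * r)).
  by ring.
have algr (t a b c p q r : R) :
    a * b + c + t * (r * (a * p + q)) = a * (b + t * (r * p)) + (c + t * (r * q)).
  by ring.
split=> [v|u] a x y; rewrite /ext_form /= ?linearPl ?linearP /=.
  exact: algl.
exact: algr.
Qed.

HB.instance Definition _ (V : vectType R) (g : {symmetric V}) :=
  bilinear_isBilinear.Build R (V * R^o)%type (V * R^o)%type R
    (GRing.Scale.Law.clone _ _ ( *%R ) _)
    (GRing.Scale.Law.clone _ _ (idfun \; *%R ) _)
    (ext_form g) (ext_form_bilinear g).

Fact ext_form_sym (V : vectType R) (g : {symmetric V}) (u v : V * R^o) :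
  ext_form g u v = (-1) ^+ false * idfun (ext_form g v u).
Proof.
rewrite /ext_form expr0 mul1r /= (hermitian_subproof (s := g)) expr0 mul1r /=.
by rewrite [u.2 * _]mulrC.
Qed.

HB.instance Definition _ (V : vectType R) (g : {symmetric V}) :=
  isHermitianSesquilinear.Build R (V * R^o)%type false idfun
    (ext_form g) (ext_form_sym g).

Definition ext_formS (V : vectType R) (g : {symmetric V}) :
  {symmetric (V * R^o)%type} := ext_form g.

Fact ext_nondeg (V : vectType R) (g : {symmetric V}) :
  nondegenerate g -> nondegenerate (ext_formS g).
Proof.
move=> /eqP g_nd; apply/eqP/vspaceP => u; rewrite memv0.
apply/idP/eqP; last first.
  by move=> ->; apply: mem0v.
move=> /mem_orthovP uP; rewrite [u]surjective_pairing; congr (_, _).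
  apply/eqP; rewrite -memv0 -g_nd; apply/mem_orthovP => v _.
  have /= := uP (v, 0) (memvf _).
  by rewrite /ext_form /= mulr0 mulr0 addr0.
have /= := uP (0, 1) (memvf _).
rewrite /ext_form /= linear0 add0r mulr1 => /eqP.
by rewrite mulf_eq0 signr_eq0 => /eqP.
Qed.

Fact ext_dim (V : vectType R) (m : nat) :
  \dim {:V} = m -> \dim {:(V * R^o)%type} = m.+1.
Proof. by rewrite !dimvf => <-; exact: addn1. Qed.

Definition ext_ips (m : nat) (E : innerProductSpace R m) :
  innerProductSpace R m.+1 :=
  @InnerProductSpace R m.+1 (E * R^o)%type (ext_dim (ips_dim E))
    (ext_formS (ips_form E)) (ext_nondeg (ips_nondeg E)).

Section ExtCurv.
Variables (V : vectType R) (A : curvTensor V).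

Definition ext_fun (x y z w : V * R^o) : R := A x.1 y.1 z.1 w.1.

Fact ext_lin1 y z w : scalar (fun x => ext_fun x y z w).
Proof. by move=> a u v; apply: (curv_lin1 A). Qed.
Fact ext_lin2 x z w : scalar (fun y => ext_fun x y z w).
Proof. by move=> a u v; apply: (curv_lin2 A). Qed.
Fact ext_lin3 x y w : scalar (fun z => ext_fun x y z w).
Proof. by move=> a u v; apply: (curv_lin3 A). Qed.
Fact ext_lin4 x y z : scalar (fun w => ext_fun x y z w).
Proof. by move=> a u v; apply: (curv_lin4 A). Qed.

Definition ext_curv : curvTensor (V * R^o)%type :=
  @CurvTensor R (V * R^o)%type ext_fun ext_lin1 ext_lin2 ext_lin3 ext_lin4
    (fun x y z w => curv_anti A x.1 y.1 z.1 w.1)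
    (fun x y z w => curv_pair A x.1 y.1 z.1 w.1)
    (fun x y z w => curv_bianchi A x.1 y.1 z.1 w.1).

End ExtCurv.

Definition restr (m : nat) (P : invFamily R m.+1) : invFamily R m :=
  fun E A x y => P (ext_ips E) (ext_curv A) (x, 0) (y, 0).

End Extension.

(* Main.v *)
From HB Require Import structures.
Require Import Defs.
From mathcomp Require Import all_boot all_order all_algebra all_fingroup.
From mathcomp Require Import sesquilinear reals boolp ring zify.

(** The argument is invariant theory for the orthogonal groups, in the one case
    that matters here. Write an invariant as a combination of complete
    contractions of [l] copies of [A] and the two free vectors. A contraction is
    a perfect matching of the [4 * l + 2] slots, so an invariant is given by
    coefficients [d] on matchings which make sense in every dimension at once:
    [contr d] is the contraction of the curvature tensors with
    [matching_comb d], the combination of products of inner products that the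
    matchings define. As a curvature tensor extended by zero is contracted in the
    same way in the larger space, restriction keeps the coefficients
    ([restr_contr]); this gives the first claim. It also shows that an
    invariant is in the kernel when its coefficients give zero in dimension
    [m - 1].

    To read off coefficients one must pass from curvature tensors to arbitrary
    vectors. Polarization ([polarized]) evaluates an invariant on sums of
    Kulkarni-Nomizu products [kn] of vectors. The result is again a combination
    of matchings of the vectors, with coefficients [polar_coef d]
    ([polarized_contr]); and because the curvature tensors are generated by
    such products, [polar_coef d] gives back the invariant ([contr_polar]). At
    vectors [e (chi z)], for orthonormal [e] and a colouring [chi] of the slots,
    the combination takes the value [colour_val d chi], which sums the
    coefficients of the matchings of equally coloured slots. In dimension at
    least [2 * l + 1] every matching has a colouring of its own, so an invariant
    that vanishes there vanishes everywhere ([contr0_dim_gt]): the second claim.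

    In dimension [2 * l], one colour short of that, vanishing says that
    [colour_val] is zero as soon as one of the [2 * l + 1] colours is missing.
    What survives are the colourings that use each colour twice. Giving the same
    colour to two classes [{a, b}] and [{a', c}] yields
      [colour_val {ab,a'c} + colour_val {aa',bc} + colour_val {ac,a'b} = 0]
    ([colour_val_merge]). Now [kn] is symmetric in two pairs of vectors, and the
    invariant is symmetric in the free ones. If [a] and [a'] form such a pair,
    the first and the third term agree, and [colour_val {ab,a'c}] is determined
    by a colouring with more monochromatic pairs. So all values are determined
    by the one where every pair is monochromatic ([colour_val_eq0]), and the
    kernel has dimension at most one ([contr0_dim_eq]).

    Finally [Tinv] is the symmetrization in the free vectors of the contraction
    whose coefficients are those of a determinant of size [2 * l + 1] ([TinvE]). In dimension [2 * l] two rows of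
    that determinant agree ([Tinv_dim0]), and its value at the monochromatic
    colouring is not zero ([polarized_Tinv_neq0]), so it spans the kernel. *)

Set Implicit Arguments.
Unset Strict Implicit.
Unset Printing Implicit Defensive.

Import GRing.Theory.
Local Open Scope ring_scope.

(** * Multilinear functions of a family of vectors *)

Section Multilinear.
Variable R : realType.

Definition update (S : eqType) (V : Type) (v : S -> V) (i : S) (x : V) : S -> V :=
  fun k => if k == i then x else v k.

Definition multilinear (S : eqType) (V : vectType R) (H : (S -> V) -> R) :=
  forall v i, scalar (fun x => H (update v i x)).

Lemma update_eq (S : eqType) (V : Type) (v : S -> V) (i : S) (x : V) :
  update v i x i = x.
Proof. by rewrite /update eqxx. Qed.

Lemma update_neq (S : eqType) (V : Type) (v : S -> V) (i k : S) (x : V) :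
  k != i -> update v i x k = v k.
Proof. by rewrite /update => /negPf ->. Qed.

Lemma scalar_sum (V : vectType R) (f : V -> R) (I : finType) (a : I -> R)
    (b : I -> V) :
  scalar f -> f (\sum_i a i *: b i) = \sum_i a i * f (b i).
Proof.
move=> f_lin.
have f0 : f 0 = 0 by have := f_lin (-1) 0 0; rewrite scaler0 addr0 mulN1r addNr.
by apply: (big_ind2 (fun x y => f x = y)) => [//|x1 x2 y1 y2 <- <-|i _];
  [rewrite -[x1]scale1r f_lin mul1r scale1r | rewrite -[_ *: _]addr0 f_lin f0 addr0].
Qed.

(** Slots are expanded one at a time; the slots that are still to be expanded
    are those whose row of [M] is not yet a row of the identity matrix. *)
Lemma multilinear_expand (S I : finType) (V : vectType R) (H : (S -> V) -> R)
    (M : S -> I -> R) (c : I -> V) :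
  multilinear H ->
  H (fun k => \sum_i M k i *: c i) =
  \sum_(a : {ffun S -> I}) (\prod_k M k (a k)) * H (fun k => c (a k)).
Proof.
move=> H_lin.
have sum_delta (t : I) : \sum_i (i == t)%:R *: c i = c t.
  rewrite (bigD1 t) //= eqxx scale1r big1 ?addr0 // => i /negPf ->.
  by rewrite scale0r.
suff expand (r : seq S) N :
    (forall k, k \notin r -> exists t, forall i, N k i = (i == t)%:R) ->
    H (fun k => \sum_i N k i *: c i) =
    \sum_(a : {ffun S -> I}) (\prod_k N k (a k)) * H (fun k => c (a k)).
  by apply: (expand (enum S)) => k; rewrite mem_enum.
elim: r N => [|k0 r IHr] N N_delta.
  have [t Nt] : exists t : {ffun S -> I}, forall k i, N k i = (i == t k)%:R.
    have [t Nt] := fin_all_exists (fun k => N_delta k isT).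
    by exists (finfun t) => k i; rewrite Nt ffunE.
  rewrite (bigD1 t) //= big1 ?mul1r => [|k _]; last by rewrite Nt eqxx.
  rewrite big1 ?addr0 => [|a]; last first.
    move=> /eqP aN; have [k /eqP akN] : exists k, a k != t k.
      apply/existsP; rewrite -negb_forall; apply/negP => /forallP a_t.
      by apply: aN; apply/ffunP => k; apply/eqP.
    by rewrite (bigD1 k) //= Nt; case: eqP => // _; rewrite !mul0r.
  by congr H; apply: funext => k; under eq_bigr do rewrite Nt; rewrite sum_delta.
pose Nd j k i := if k == k0 then (i == j)%:R else N k i.
have NdE j : H (fun k => \sum_i Nd j k i *: c i) =
    \sum_(a : {ffun S -> I}) (\prod_k Nd j k (a k)) * H (fun k => c (a k)).
  apply: IHr => k kr; rewrite /Nd; have [_|kk0] := eqVneq k k0; first by exists j.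
  by apply: N_delta; rewrite inE negb_or kk0.
pose w k := \sum_i N k i *: c i.
have -> : (fun k => \sum_i N k i *: c i) = update w k0 (\sum_j N k0 j *: c j).
  by apply: funext => k; rewrite /update; have [->|] := eqVneq k k0.
rewrite (scalar_sum _ _ (H_lin w k0)).
under eq_bigr => j _.
  have -> : update w k0 (c j) = fun k => \sum_i Nd j k i *: c i.
    apply: funext => k; rewrite /update /Nd.
    by have [_|//] := eqVneq k k0; rewrite sum_delta.
  rewrite NdE mulr_sumr; over.
rewrite exchange_big; apply: eq_bigr => a _ /=.
under eq_bigr do rewrite mulrA; rewrite -mulr_suml; congr (_ * _).
rewrite (bigD1 (a k0)) //= [X in _ + X]big1 ?addr0 => [|j].
  rewrite [LHS]mulrC (bigD1 k0) //= /Nd !eqxx mul1r [RHS](bigD1 k0) //= mulrC.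
  by congr (_ * _); apply: eq_bigr => k /negPf ->.
move=> /negPf ja; rewrite (bigD1 k0) //= /Nd eqxx eq_sym ja mul0r mulr0 //.
Qed.

End Multilinear.

(** * Inner product spaces *)

Section InnerProduct.
Variables (R : realType) (m : nat) (E : innerProductSpace R m).
Local Notation I := 'I_(\dim {:E}).
Local Notation g := (ips_form E).

Lemma ips_formC x y : g x y = g y x.
Proof. by rewrite (hermitian_subproof (s := ips_form E)) expr0 mul1r. Qed.

Lemma form_scalarl y : scalar (g ^~ y).
Proof. by move=> a u v; rewrite /= ips_formC linearP /= ![g y _]ips_formC. Qed.

Lemma form_inj x y : (forall z, g x z = g y z) -> x = y.
Proof.
move=> xy; apply/eqP; rewrite -subr_eq0 -memv0 -(eqP (ips_nondeg E)).
by apply/mem_orthovP => z _; rewrite linearBl /= xy subrr.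
Qed.

Definition bdual (i : I) : E := \sum_j ginv i j *: bvec j.

Lemma bcovec_sum (x : E) : x = \sum_i bcovec i x *: bvec i.
Proof. exact: coord_vbasis (memvf x). Qed.

Lemma coord_bvec (i j : I) : coord (vbasis {:E}) i (bvec j) = (i == j)%:R.
Proof.
by rewrite /bvec coord_free ?(basis_free (vbasisP _)) // eq_sym.
Qed.

Lemma gram_unit : \matrix_(a, b) g (bvec a) (bvec b) \in unitmx.
Proof.
rewrite -row_free_unit -kermx_eq0; apply/eqP/row_matrixP => i.
set u := row i _; rewrite row0; apply/rowP => j.
have uG : u *m \matrix_(a, b) g (bvec a) (bvec b) = 0.
  by rewrite -row_mul mulmx_ker row0.
have x0 : \sum_a u 0 a *: bvec a = 0 :> E.
  apply: form_inj => z; rewrite [z]bcovec_sum !linear_sumr /=.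
  apply: eq_bigr => b _; rewrite !linearZ /= linear0l; congr (_ * _).
  have := congr1 (fun w : 'rV_ _ => w 0 b) uG; rewrite !mxE => <-.
  rewrite linear_sumlz; apply: eq_bigr => a _.
  by rewrite linearZl_LR /= mxE.
have := congr1 (coord (vbasis {:E}) j) x0; rewrite [RHS]linear0 linear_sum.
rewrite (bigD1 j) //= linearZ /= coord_bvec eqxx mulr1.
rewrite big1 => [|k kj]; last first.
  by rewrite linearZ /= coord_bvec eq_sym (negPf kj) mulr0.
by rewrite addr0 => ->; rewrite mxE.
Qed.

Lemma form_bdual i x : g (bdual i) x = bcovec i x.
Proof.
rewrite {1}[x]bcovec_sum linear_sumr /=.
rewrite (eq_bigr (fun k => (i == k)%:R * bcovec k x)).
  rewrite (bigD1 i) //= eqxx mul1r big1 ?addr0 // => k /negPf.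
  by rewrite eq_sym => ->; rewrite mul0r.
move=> k _; rewrite linearZ /= mulrC; congr (_ * _).
rewrite linear_sumlz.
have := congr1 (fun A : 'M_ _ => A i k) (mulVmx gram_unit); rewrite !mxE => <-.
by apply: eq_bigr => j _; rewrite linearZl_LR /= mxE.
Qed.

Lemma sum_bvec x : x = \sum_i g (bdual i) x *: bvec i.
Proof. by under eq_bigr do rewrite form_bdual; apply: bcovec_sum. Qed.

Lemma sum_bdual x : x = \sum_i g (bvec i) x *: bdual i.
Proof.
apply: form_inj => z; rewrite linear_sumlz ips_formC {1}[z]sum_bvec linear_sumlz.
apply: eq_bigr => i _; rewrite !linearZl_LR /=; exact: mulrC.
Qed.

Lemma form_bvec_bdual i j : g (bvec i) (bdual j) = (i == j)%:R.
Proof. by rewrite ips_formC form_bdual /bcovec coord_bvec eq_sym. Qed.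

Lemma ginv_bdual i j : ginv i j = g (bdual i) (bdual j).
Proof.
rewrite {1}/bdual linear_sumlz (bigD1 j) //= big1 ?addr0 => [|k kj].
  by rewrite linearZl_LR /= form_bvec_bdual eqxx mulr1.
by rewrite linearZl_LR /= form_bvec_bdual (negPf kj) mulr0.
Qed.

End InnerProduct.

(** Full contraction of [H] with [F], in a basis and its dual. If [p] and
    [iota] are adjoint, the expansions of [p] and of [iota] in the two pairs of
    bases have the same coefficients, so [p] can be moved from one factor to
    the other as [iota]. For identity maps this says that the contraction does
    not depend on the basis. *)
Lemma contraction_adjoint (R : realType) (m m' : nat)
    (E : innerProductSpace R m) (E' : innerProductSpace R m') (S : finType)
    (p : E' -> E) (iota : E -> E') (H : (S -> E) -> R) (F : (S -> E') -> R) :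
  (forall x y, ips_form E x (p y) = ips_form E' (iota x) y) ->
  multilinear H -> multilinear F ->
  \sum_(j : {ffun S -> 'I_(\dim {:E'})})
    H (fun k => p (bvec (j k))) * F (fun k => bdual (j k)) =
  \sum_(j : {ffun S -> 'I_(\dim {:E})})
    H (fun k => bvec (j k)) * F (fun k => iota (bdual (j k))).
Proof.
move=> adj H_lin F_lin.
pose M (a : 'I_(\dim {:E})) (b : 'I_(\dim {:E'})) :=
  ips_form E' (iota (bdual a)) (bvec b).
transitivity (\sum_(j : {ffun S -> 'I_(\dim {:E'})})
    \sum_(a : {ffun S -> 'I_(\dim {:E})})
    (\prod_k M (a k) (j k)) * H (fun k => bvec (a k)) * F (fun k => bdual (j k))).
  apply: eq_bigr => j _; rewrite -mulr_suml; congr (_ * _).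
  rewrite -(multilinear_expand (fun k i => M i (j k)) _ H_lin); congr H.
  apply: funext => k; rewrite {1}[p _]sum_bvec.
  by apply: eq_bigr => i _; rewrite adj.
rewrite exchange_big; apply: eq_bigr => a _ /=.
rewrite (_ : (fun k => iota (bdual (a k))) =
             fun k => \sum_i M (a k) i *: bdual i).
  rewrite (multilinear_expand (fun k i => M (a k) i) _ F_lin) mulr_sumr.
  by apply: eq_bigr => j _; rewrite mulrA; congr (_ * _); apply: mulrC.
apply: funext => k; rewrite {1}[iota _]sum_bdual.
by apply: eq_bigr => i _; rewrite /M ips_formC.
Qed.

(** * Perfect matchings and the invariants that they define *)

Section Matchings.
Variables (R : realType) (P : finType).
Local Notation Slot := (P * bool)%type.
Implicit Types (s h : {perm Slot}) (d : {perm Slot} -> R).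

Section Form.
Variables (m : nat) (E : innerProductSpace R m).

(** Any permutation that takes the standard pairs, which differ in the second
    component only, to the pairs of a matching stands for that matching. *)
Definition matching_prod s (v : Slot -> E) : R :=
  \prod_p ips_form E (v (s (p, false))) (v (s (p, true))).

Definition matching_comb d (v : Slot -> E) : R := \sum_s d s * matching_prod s v.

Lemma matching_prod_multilinear s : multilinear (matching_prod s).
Proof.
move=> v z a x y; set p0 := ((s^-1)%g z).1.
have other p b : p != p0 -> s (p, b) != z.
  by apply: contraNneq => zE; rewrite /p0 -zE permK.
pose c := \prod_(p | p != p0) ips_form E (v (s (p, false))) (v (s (p, true))).
have gmE w : matching_prod s (update v z w) = ips_form E (update v z w (s (p0, false)))
                                  (update v z w (s (p0, true))) * c.
  rewrite /matching_prod (bigD1 p0) //=; congr (_ * _); apply: eq_bigr => p pp0.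
  by rewrite !update_neq ?other.
rewrite !gmE; have zE : z = s (p0, ((s^-1)%g z).2).
  by rewrite /p0 -surjective_pairing permKV.
case: (((s^-1)%g z).2) zE => zE.
  have Nz : s (p0, false) != z by rewrite zE (inj_eq perm_inj) xpair_eqE andbF.
  by rewrite -zE !update_eq !(update_neq _ _ Nz) linearP /= mulrDl mulrA.
have Nz : s (p0, true) != z by rewrite zE (inj_eq perm_inj) xpair_eqE andbF.
rewrite -zE !update_eq !(update_neq _ _ Nz).
by rewrite [X in X * c](form_scalarl (v (s (p0, true))) a x y) mulrDl mulrA.
Qed.

Lemma matching_comb_multilinear d : multilinear (matching_comb d).
Proof.
move=> v z a x y; rewrite /matching_comb mulr_sumr -big_split /=; apply: eq_bigr => s _.
by rewrite matching_prod_multilinear; ring.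
Qed.

End Form.

Definition paired h : bool := [forall p, (h (p, false)).1 == (h (p, true)).1].

(** As [h] permutes the standard pairs and exchanges elements within them, [s] and
    [h * s] stand for the same matching. *)
Lemma matching_prod_paired m (E : innerProductSpace R m) h s (v : Slot -> E) :
  paired h -> matching_prod (h * s)%g v = matching_prod s v.
Proof.
move=> /forallP h_pair; pose q p := (h (p, false)).1.
have hE p b : h (p, b) = (q p, (h (p, b)).2).
  by rewrite [LHS]surjective_pairing; case: b; rewrite /q // (eqP (h_pair p)).
have h2 p : (h (p, true)).2 = ~~ (h (p, false)).2.
  case: (boolP ((h (p, true)).2 == ~~ (h (p, false)).2)) => [/eqP //|].
  move=> h2; suff : (p, true) = (p, false) by [].
  apply: (@perm_inj _ h); rewrite [LHS]hE [RHS]hE; congr (_, _).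
  by case: (h (p, true)).2 (h (p, false)).2 h2 => - [].
have q_inj : injective q.
  move=> p p' qq; case: (eqVneq (h (p, false)).2 (h (p', false)).2) => e2.
    have : h (p, false) = h (p', false) by rewrite [LHS]hE [RHS]hE qq e2.
    by move/perm_inj => [].
  have : h (p, false) = h (p', true).
    rewrite [LHS]hE [RHS]hE qq h2; congr (_, _).
    by case: (h (p, false)).2 (h (p', false)).2 e2 => - [].
  by move/perm_inj => [].
rewrite /matching_prod [RHS](reindex_inj q_inj); apply: eq_bigr => p _.
rewrite !permM [h (p, true)]hE [h (p, false)]hE h2 /=.
case: (h (p, false)).2 => //=; exact: ips_formC.
Qed.

Definition compat (C : eqType) s (chi : Slot -> C) :=
  [forall p, chi (s (p, false)) == chi (s (p, true))].

(** The value of [matching_comb d] at orthonormal vectors indexed by the colours,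
    see [matching_comb_orthonormal]. *)
Definition colour_val (C : eqType) d (chi : Slot -> C) : R :=
  \sum_s d s * (compat s chi)%:R.

Lemma matching_comb_orthonormal m (E : innerProductSpace R m) d (C : eqType)
    (chi : Slot -> C) (e : C -> E) :
  (forall z z', ips_form E (e (chi z)) (e (chi z')) = (chi z == chi z')%:R) ->
  matching_comb d (fun z => e (chi z)) = colour_val d chi.
Proof.
move=> e_on; rewrite /matching_comb /colour_val; apply: eq_bigr => s _.
congr (_ * _); rewrite /matching_prod.
have [/forallP all_eq|/forallPn[p pN]] := boolP (compat s chi).
  by rewrite big1 // => p _; rewrite e_on all_eq.
by rewrite (bigD1 p) //= e_on (negPf pN) mul0r.
Qed.

(** The colouring by the pairs of [s] is compatible with the matching of [s] only,
    so [colour_val] reads off its coefficient. The factor is the number of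
    permutations that stand for the same matching. *)
Lemma matching_comb_colour m (E : innerProductSpace R m) d (v : Slot -> E) :
  #|paired|%:R * matching_comb d v =
  \sum_(s : {perm Slot}) colour_val d (fun z => ((s^-1)%g z).1) * matching_prod s v.
Proof.
under [RHS]eq_bigr do rewrite /colour_val mulr_suml.
rewrite exchange_big /matching_comb mulr_sumr; apply: eq_bigr => s' _ /=.
transitivity (\sum_(h : {perm Slot}) (paired h)%:R * (d s' * matching_prod s' v)).
  by rewrite -mulr_suml -natr_sum -big_mkcond /= sum1_card. 
rewrite (reindex_inj (inj_comp (mulgI s') invg_inj)) /=.
apply: eq_bigr => s _; rewrite -mulrA mulrCA.
have -> : compat s' (fun z => ((s^-1)%g z).1) = paired (s' * s^-1)%g.
  by apply: eq_forallb => p; rewrite !permM.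
congr (_ * _).
have [sp|_] := boolP (paired _); last by rewrite !mul0r.
by rewrite !mul1r -(matching_prod_paired s v sp) mulgKV.
Qed.

Lemma paired_neq0 : #|paired|%:R != 0 :> R.
Proof.
rewrite Num.Theory.pnatr_eq0 -lt0n; apply/card_gt0P; exists 1%g.
by apply/forallP => p; rewrite !perm1.
Qed.

Lemma colour_val0_matching_comb0 d :
  (forall chi : Slot -> P, colour_val d chi = 0) ->
  forall m (E : innerProductSpace R m) (v : Slot -> E), matching_comb d v = 0.
Proof.
move=> val0 m E v; apply: (mulfI paired_neq0).
by rewrite mulr0 matching_comb_colour big1 // => s _; rewrite val0 mul0r.
Qed.

Lemma colour_val_inj (C C' : eqType) d (chi : Slot -> C) (f : C -> C') :
  injective f -> colour_val d (fun z => f (chi z)) = colour_val d chi.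
Proof.
move=> f_inj; rewrite /colour_val; apply: eq_bigr => s _; congr (_ * _%:R).
by congr nat_of_bool; apply: eq_forallb => p; rewrite inj_eq.
Qed.

Definition partner s z := s (((s^-1)%g z).1, ~~ ((s^-1)%g z).2).

Lemma partnerK s : involutive (partner s).
Proof.
move=> z; rewrite /partner permK /= negbK -surjective_pairing; exact: permKV.
Qed.

Lemma partner_neq s z : partner s z != z.
Proof.
rewrite -{2}[z](permKV s) (inj_eq perm_inj) [X in _ != X]surjective_pairing.
by rewrite xpair_eqE eqxx /=; case: (_.2).
Qed.

Lemma compatP (C : eqType) s (chi : Slot -> C) :
  reflect (forall z, chi (partner s z) = chi z) (compat s chi).
Proof.
apply: (iffP forallP) => [chi_s z|chi_s p]; last first.
  by rewrite -(chi_s (s (p, false))) /partner permK.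
rewrite /partner; have /eqP := chi_s ((s^-1)%g z).1.
case zE: (((s^-1)%g z).2) => /= chiE; [rewrite chiE|rewrite -chiE];
  by rewrite -{1}zE -surjective_pairing permKV.
Qed.

Lemma colour_val_lonely (C : eqType) d (chi : Slot -> C) z0 :
  (forall z, chi z = chi z0 -> z = z0) -> colour_val d chi = 0.
Proof.
move=> z0_only; rewrite /colour_val big1 // => s _.
have [/compatP/(_ z0)/z0_only/eqP|] := boolP (compat s chi).
  by rewrite (negPf (partner_neq _ _)).
by rewrite mulr0.
Qed.

Definition merge (C : eqType) (p q : C) (chi : Slot -> C) z :=
  if chi z == q then p else chi z.

Lemma compat_merge (C : eqType) (p q : C) (chi : Slot -> C) s w x y z :
  p != q ->
  (forall u, (chi u == p) = (u == w) || (u == x)) ->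
  (forall u, (chi u == q) = (u == y) || (u == z)) ->
  compat s chi = compat s (merge p q chi) && (partner s w == x).
Proof.
move=> pq chi_p chi_q; apply/idP/andP => [/compatP chi_s|[/compatP chi_s /eqP wx]].
  split; first by apply/compatP => u; rewrite /merge chi_s.
  have := chi_p (partner s w); rewrite chi_s chi_p eqxx /=.
  by rewrite (negPf (partner_neq s w)).
have xw : partner s x = w by rewrite -wx partnerK.
have in_p u : chi (partner s u) = p -> chi u = p.
  move=> /eqP; rewrite chi_p => u_wx; apply/eqP; rewrite chi_p.
  rewrite -[u](partnerK s); case/orP: u_wx => /eqP ->.
    by rewrite wx eqxx orbT.
  by rewrite xw eqxx.
apply/compatP => u; have := chi_s u; rewrite /merge.
have [up _|uNp] := eqVneq (chi u) p.
  have := chi_p u; rewrite up eqxx => /esym/orP[] /eqP ->; apply/eqP.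
    by rewrite wx chi_p eqxx orbT.
  by rewrite xw chi_p eqxx.
have [-> |uNq] := eqVneq (chi u) q.
  by case: eqP => // _ /in_p up; rewrite up eqxx in uNp.
by case: eqP => // _ pu; rewrite -pu eqxx in uNp.
Qed.

Lemma eq_compat (C C' : eqType) (f : Slot -> C) (f' : Slot -> C') s :
  (forall u v, (f u == f v) = (f' u == f' v)) -> compat s f = compat s f'.
Proof. by move=> ff'; apply: eq_forallb => p; apply: ff'. Qed.

Lemma compat_mergeC (C : eqType) (p q : C) (chi : Slot -> C) s w x y z :
  p != q ->
  (forall u, (chi u == p) = (u == w) || (u == x)) ->
  (forall u, (chi u == q) = (u == y) || (u == z)) ->
  compat s chi = compat s (merge p q chi) && (partner s y == z).
Proof.
move=> pq chi_p chi_q; have qp : q != p by rewrite eq_sym.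
rewrite (compat_merge s qp chi_q chi_p); congr (_ && _); apply: eq_compat => u v.
rewrite /merge; have [->|up] := eqVneq (chi u) p; have [->|vp] := eqVneq (chi v) p;
  rewrite ?eqxx ?(negPf pq) ?eqxx //.
- have [_|vq] := eqVneq (chi v) q; first by rewrite eqxx.
  by rewrite eq_sym (negPf vp).
- have [_|uq] := eqVneq (chi u) q; first by rewrite eqxx.
  by rewrite (negPf up).
have [uq|uq] := eqVneq (chi u) q; have [vq|vq] := eqVneq (chi v) q.
- by rewrite uq vq !eqxx.
- by rewrite uq !(eq_sym _ (chi v)) (negPf vp) (negPf vq).
- by rewrite vq (negPf up) (negPf uq).
- by [].
Qed.

(** The partner of [a] in the class [{a, b, a', c}] is one of [b], [c] and
    [a'], whence the three terms. *)
Lemma colour_val_merge (C : eqType) d (p q : C) (chi : Slot -> C) a a' b c :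
  p != q ->
  (forall u, (chi u == p) = (u == a) || (u == b)) ->
  (forall u, (chi u == q) = (u == a') || (u == c)) ->
  a != b -> a' != c ->
  colour_val d (merge p q chi) =
  colour_val d chi + colour_val d (fun z => chi (tperm a a' z))
    + colour_val d (fun z => chi (tperm a' b z)).
Proof.
move=> pq chi_p chi_q ab a'c.
have ap : chi a = p by apply/eqP; rewrite chi_p eqxx.
have bp : chi b = p by apply/eqP; rewrite chi_p eqxx orbT.
have a'q : chi a' = q by apply/eqP; rewrite chi_q eqxx.
have cq : chi c = q by apply/eqP; rewrite chi_q eqxx orbT.
have Dp u v : chi u = p -> chi v = q -> u != v.
  by move=> up vq; apply: contraNneq pq => uv; rewrite -up uv vq.
have aa' := Dp _ _ ap a'q; have ac := Dp _ _ ap cq.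
have ba' := Dp _ _ bp a'q; have bc := Dp _ _ bp cq.
have merge_tperm u v s : chi u = p -> chi v = q ->
    compat s (merge p q (fun z => chi (tperm u v z))) = compat s (merge p q chi).
  move=> up vq; apply: eq_compat => y z; suff E t :
    merge p q (fun z => chi (tperm u v z)) t = merge p q chi t by rewrite !E.
  by rewrite /merge; case: tpermP => [->|->|//]; rewrite up vq eqxx (negPf pq).
have tperm_eq (u v w z : Slot) : (tperm u v w == z) = (w == tperm u v z).
  by rewrite -{1}[z](tpermK u v) (inj_eq perm_inj).
rewrite /colour_val -!big_split /=; apply: eq_bigr => s _.
rewrite -!mulrDr; congr (_ * _).
have e1 := compat_merge s pq chi_p chi_q.
have e2 : compat s (fun z => chi (tperm a a' z)) =
          compat s (merge p q chi) && (partner s a == c).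
  rewrite -(merge_tperm a a') //.
  apply: (@compat_mergeC _ _ _ _ s a' b a c) => // u.
    by rewrite chi_p !tperm_eq tpermL tpermD // eq_sym.
  by rewrite chi_q !tperm_eq tpermR tpermD // eq_sym.
have e3 : compat s (fun z => chi (tperm a' b z)) =
          compat s (merge p q chi) && (partner s a == a').
  rewrite tpermC -(merge_tperm b a') //.
  apply: (@compat_merge _ _ _ _ s a a' b c) => // u.
    by rewrite chi_p !tperm_eq tpermL tpermD // eq_sym.
  by rewrite chi_q !tperm_eq tpermR tpermD // eq_sym.
rewrite e1 e2 e3 -!natrD; congr (_%:R).
have [/compatP/(_ a)|] := boolP (compat s (merge p q chi)); last by [].
have := partner_neq s a; rewrite /merge ap (negPf pq) /=.
set x := partner s a => xa; case: ifP => [|_ /eqP].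
  rewrite chi_q => /orP[] /eqP -> _.
    by rewrite eqxx (negPf a'c) eq_sym (negPf ba').
  by rewrite eqxx [c == a']eq_sym (negPf a'c) eq_sym (negPf bc).
rewrite chi_p (negPf xa) /= => /eqP ->.
by rewrite eqxx (negPf ba') (negPf bc).
Qed.

(** A colour that is missing or used only once makes the value zero, so every
    colour may be supposed to be used twice. If then the pair of [p0] is not
    monochromatic, [colour_val_merge] and the symmetry express the value by that at
    a colouring with more monochromatic pairs; if all pairs are monochromatic, the
    colouring is the standard one up to renaming the colours. *)
Lemma colour_val_eq0 d :
  (forall chi : Slot -> P, forall p,
     colour_val d (fun z => chi (tperm (p, false) (p, true) z)) = colour_val d chi) ->
  (forall (chi : Slot -> P) c0, (forall z, chi z != c0) -> colour_val d chi = 0) ->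
  colour_val d (fun z : Slot => z.1) = 0 ->
  forall chi : Slot -> P, colour_val d chi = 0.
Proof.
move=> sym missing val_fst.
pose bad (chi : Slot -> P) := [set p | chi (p, false) != chi (p, true)].
suff IH n chi : (#|bad chi| < n)%N -> colour_val d chi = 0.
  by move=> chi; apply: (IH _ _ (ltnSn _)).
elim: n chi => // n IHn chi; rewrite ltnS => chi_n.
have [/forallP all_col|/forallPn[c0 c0N]] :=
  boolP [forall c, [exists z, chi z == c]]; last first.
  by apply: (missing _ c0) => z; move: c0N; rewrite negb_exists => /forallP.
have [|/forallPn[z0]] :=
  boolP [forall z0, [exists z, (chi z == chi z0) && (z != z0)]]; last first.
  rewrite negb_exists => /forallP z0_only; apply: (@colour_val_lonely _ _ _ z0) => z zz0.
  by apply/eqP; have := z0_only z; rewrite zz0 eqxx /= negbK.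
move=> /forallP no_lonely.
pose cl c := [set z | chi z == c].
have cl_ge2 c : (2 <= #|cl c|)%N.
  have /existsP[z /eqP zc] := all_col c.
  have /existsP[z' /andP[/eqP z'z z'N]] := no_lonely z.
  rewrite (cardsD1 z) (cardsD1 z') !inE zc z'z zc eqxx z'N /= //.
have cl_2 c : #|cl c| = 2.
  have sum_cl : (\sum_c #|cl c| = #|P| * 2)%N.
    rewrite -card_bool -card_prod -sum1_card (partition_big chi xpredT) //=.
    by apply: eq_bigr => c' _; rewrite -sum1_card; apply: eq_bigl => z; rewrite inE.
  have := leqif_sum (fun c' (_ : true) => leqif_eq (cl_ge2 c')).
  rewrite sum_cl sum_nat_const => -[_]; rewrite eqxx => /esym/forallP/(_ c).
  by move=> /eqP.
have cl_other z : exists2 z', z' != z &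
    forall u, (chi u == chi z) = (u == z) || (u == z').
  have /cards2P[x [y [xy clE]]] : #|cl (chi z)| == 2 by rewrite cl_2.
  have clP u : (chi u == chi z) = (u == x) || (u == y).
    by have := congr1 (fun A : {set _} => u \in A) clE; rewrite !inE.
  have := clP z; rewrite eqxx => /esym/orP[] /eqP zE.
    by exists y => [|u]; rewrite ?clP zE // eq_sym.
  by exists x => [|u]; rewrite ?clP zE // orbC.
have [/eqP bad0|/set0Pn[p0]] := boolP (bad chi == set0).
  pose f p := chi (p, false).
  have chiE z : chi z = f z.1.
    case: z => p [] //=; have := in_set0 p; rewrite -bad0 inE.
    by move/negbFE/eqP.
  have /fin_all_exists[f' f'K] c : exists p, f p = c.
    by have /existsP[z /eqP zc] := all_col c; exists z.1; rewrite -chiE.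
  have -> : chi = fun z => f z.1 by apply: funext.
  by rewrite colour_val_inj //; apply: can_inj (canF_sym f'K).
rewrite inE; set a := (p0, false); set a' := (p0, true) => aa'.
have [b ba a_cl] := cl_other a; have [c ca a'_cl] := cl_other a'.
have := colour_val_merge d aa' a_cl a'_cl; rewrite eq_sym => /(_ ba).
rewrite eq_sym => /(_ ca); rewrite sym.
have -> : colour_val d (merge (chi a) (chi a') chi) = 0.
  apply: (missing _ (chi a')) => z; rewrite /merge.
  by case: ifPn.
have ba' : b != a'.
  by apply: contraNneq aa' => <-; rewrite eq_sym a_cl eqxx orbT.
rewrite [X in _ + X]IHn => [/eqP|]; last first.
  apply: leq_trans chi_n; apply: proper_card; apply/properP; split; last first.
    exists p0; rewrite !inE // -/a -/a' tpermL tpermD ?negbK.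
    - by rewrite eq_sym a_cl eqxx orbT.
    - by rewrite xpair_eqE andbF.
    - by rewrite ba.
  apply/subsetP => p; rewrite !inE.
  have [->|pp0] := eqVneq p p0.
    by rewrite -/a -/a' tpermL tpermD ?xpair_eqE ?andbF // eq_sym a_cl eqxx orbT.
  have Na' x : a' != (p, x) by rewrite xpair_eqE eq_sym (negPf pp0).
  have Na x : (p, x) != a by rewrite xpair_eqE (negPf pp0).
  have [bE _|bp] := eqVneq b.1 p; last first.
    by rewrite !tpermD // -?[b]surjective_pairing; apply: contraNneq bp => ->.
  have chib : chi b = chi a by apply/eqP; rewrite a_cl eqxx orbT.
  have Nchi x : (p, x) != b -> chi (p, x) != chi a.
    by move=> xb; rewrite a_cl negb_or Na xb.
  case bE2 : b.2.
    have bE' : b = (p, true) by rewrite [b]surjective_pairing bE bE2.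
    by rewrite -bE' chib; apply: Nchi; rewrite bE' xpair_eqE andbF.
  have bE' : b = (p, false) by rewrite [b]surjective_pairing bE bE2.
  by rewrite -bE' chib eq_sym; apply: Nchi; rewrite bE' xpair_eqE andbF.
by rewrite addr0 eq_sym -mulr2n Num.Theory.mulrn_eq0 /= => /eqP.
Qed.

End Matchings.

(** * Contractions of curvature tensors *)

(** The argument number [2 * a + b] of the [k]-th curvature tensor is the slot
    [((k, b), a)]: first and third argument form a pair, and so do second and
    fourth. The pair [None] consists of the two free slots. *)
Notation argPair l := ('I_l * bool)%type.
Notation argSlot l := (argPair l * bool)%type.
Notation slot l := (option (argPair l) * bool)%type.

Section Contraction.
Variables (R : realType) (l : nat).

Definition join (V : Type) (w : argSlot l -> V) (x y : V) : slot l -> V :=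
  fun z => if z.1 is Some p then w (p, z.2) else if z.2 then y else x.

Lemma join_update (V : Type) (w : argSlot l -> V) z t x y :
  join (update w z t) x y = update (join w x y) (Some z.1, z.2) t.
Proof.
apply: funext => -[[p|] b]; rewrite /join /update //=; case: z => q c.
Qed.

Definition block (V : Type) (A : V -> V -> V -> V -> R) (v : bool * bool -> V) :=
  A (v (false, false)) (v (true, false)) (v (false, true)) (v (true, true)).

Definition curv_prod (V : Type) (A : 'I_l -> V -> V -> V -> V -> R)
    (v : argSlot l -> V) : R :=
  \prod_k block (A k) (fun c => v ((k, c.1), c.2)).

Lemma curv_prod_multilinear (V : vectType R) (A : 'I_l -> curvTensor V) :
  multilinear (curv_prod A).
Proof.
move=> v [[k0 b0] a0] a x y.
pose c := \prod_(k | k != k0) block (A k) (fun c => v ((k, c.1), c.2)).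
have etaE w : curv_prod A (update v (k0, b0, a0) w) =
    block (A k0) (update (fun c => v ((k0, c.1), c.2)) (b0, a0) w) * c.
  rewrite /curv_prod (bigD1 k0) //=; congr (_ * _).
    congr block; apply: funext => -[b a']; rewrite /update /=.
    by rewrite !xpair_eqE eqxx.
  apply: eq_bigr => k kk0; congr block; apply: funext => -[b a'].
  by rewrite update_neq // !xpair_eqE (negPf kk0).
rewrite !etaE mulrA -mulrDl; congr (_ * c); rewrite /block {etaE}.
by case: b0 a0 => -[]; rewrite /update /= ?(curv_lin1 (A k0)) ?(curv_lin2 (A k0))
  ?(curv_lin3 (A k0)) ?(curv_lin4 (A k0)).
Qed.

(** The arguments of [A] run through a basis and those of the matchings
    through its dual, so the matchings contract [A] with itself and with [x]
    and [y]. The coefficients [d] do not depend on the space. *)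
Definition contr (d : {perm slot l} -> R) (m : nat) : invFamily R m :=
  fun E A x y =>
  \sum_(j : {ffun argSlot l -> 'I_(\dim {:E})})
    curv_prod (fun _ => A) (fun z => bvec (j z)) *
    matching_comb d (join (fun z => bdual (j z)) x y : _ -> E).

Lemma join_multilinear m (E : innerProductSpace R m) d (x y : E) :
  multilinear (fun w : argSlot l -> E => matching_comb d (join w x y)).
Proof. by move=> v z a t u; rewrite !join_update matching_comb_multilinear. Qed.

(** The projection to [E], through which [ext_curv A] factors, is adjoint to the
    inclusion, which preserves the inner products that the matchings take. *)
Lemma restr_contr (d : {perm slot l} -> R) (s : bool) (n : nat) :
  fam_eq (restr s (contr d (m := n.+1))) (contr d (m := n)).
Proof.
move=> E A x y; rewrite /restr /contr.
pose iota (u : E) : ext_ips s E := (u, 0).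
pose p (u : ext_ips s E) : E := u.1.
have adj u v : ips_form E u (p v) = ips_form (ext_ips s E) (iota u) v.
  by rewrite /= /ext_form /= mul0r mulr0 addr0.
rewrite (contraction_adjoint (iota := iota) (p := p) adj
           (curv_prod_multilinear (fun _ => A)) (join_multilinear d (iota x) (iota y))).
apply: eq_bigr => j _; congr (_ * _); apply: eq_bigr => t _; congr (_ * _).
apply: eq_bigr => q _.
have joinE z : join (fun z => iota (bdual (j z))) (iota x) (iota y) z =
    iota (join (fun z => bdual (j z)) x y z).
  by case: z => [[q'|] []].
by rewrite !joinE -adj.
Qed.

Lemma contr_lin (c : R) (d d' : {perm slot l} -> R) m (E : innerProductSpace R m)
    (A : curvTensor E) (x y : E) :
  contr (fun s => d s + c * d' s) A x y = contr d A x y + c * contr d' A x y.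
Proof.
rewrite /contr mulr_sumr -big_split; apply: eq_bigr => j _ /=.
rewrite mulrCA -mulrDr; congr (_ * _).
by rewrite /matching_comb mulr_sumr -big_split; apply: eq_bigr => s _ /=; ring.
Qed.

End Contraction.

(** * Polarization *)

Lemma curvTensor_eq (R : realType) (V : vectType R) (A B : curvTensor V) :
  (forall x y z w, A x y z w = B x y z w) -> A = B.
Proof.
case: A B => [A ? ? ? ? ? ? ?] [B ? ? ? ? ? ? ?] /= AB.
have {}AB : A = B by do 4![apply: funext => ?]; apply: AB.
by subst B; congr CurvTensor; apply: Prop_irrelevance.
Qed.

Section Kulkarni.
Variables (R : realType) (m : nat) (E : innerProductSpace R m).
Local Notation g := (ips_form E).
Variables u0 u1 u2 u3 : E.

Let sp (u v x y : E) := g u x * g v y + g v x * g u y.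

(** A multiple of the Kulkarni-Nomizu product of the symmetric products
    of [u0] with [u2] and of [u1] with [u3], normalized as required by
    [sum_curv]. *)
Definition kn_fun (x y z w : E) : R :=
  12^-1 * (sp u0 u2 x z * sp u1 u3 y w + sp u1 u3 x z * sp u0 u2 y w
         - sp u0 u2 x w * sp u1 u3 y z - sp u1 u3 x w * sp u0 u2 y z).

Fact kn_lin1 y z w : scalar (fun x => kn_fun x y z w).
Proof. by move=> a u v; rewrite /kn_fun /sp !linearP /=; ring. Qed.
Fact kn_lin2 x z w : scalar (fun y => kn_fun x y z w).
Proof. by move=> a u v; rewrite /kn_fun /sp !linearP /=; ring. Qed.
Fact kn_lin3 x y w : scalar (fun z => kn_fun x y z w).
Proof. by move=> a u v; rewrite /kn_fun /sp !linearP /=; ring. Qed.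
Fact kn_lin4 x y z : scalar (fun w => kn_fun x y z w).
Proof. by move=> a u v; rewrite /kn_fun /sp !linearP /=; ring. Qed.
Fact kn_anti x y z w : kn_fun x y z w = - kn_fun y x z w.
Proof. by rewrite /kn_fun /sp; ring. Qed.
Fact kn_pair x y z w : kn_fun x y z w = kn_fun z w x y.
Proof. by rewrite /kn_fun /sp; ring. Qed.
Fact kn_bianchi x y z w : kn_fun x y z w + kn_fun y z x w + kn_fun z x y w = 0.
Proof. by rewrite /kn_fun /sp; ring. Qed.

Definition kn : curvTensor E :=
  CurvTensor kn_lin1 kn_lin2 kn_lin3 kn_lin4 kn_anti kn_pair kn_bianchi.

End Kulkarni.

(** The 16 terms of [kn] and their signs: [c.1] exchanges the vectors within
    the two pairs, [c.2.1] exchanges the pairs, and [c.2.2] exchanges the last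
    two arguments. *)
Notation knTerm := ((bool * bool) * (bool * bool))%type.

Definition rho (c : knTerm) (z : bool * bool) : bool * bool :=
  let b := z.1 (+) (z.2 && c.2.2) (+) c.2.1 in
  (b, z.2 (+) (if b then c.1.2 else c.1.1)).

Definition rhoV (c : knTerm) (z : bool * bool) : bool * bool :=
  let a := z.2 (+) (if z.1 then c.1.2 else c.1.1) in
  (z.1 (+) c.2.1 (+) (a && c.2.2), a).

Lemma rhoK c : cancel (rho c) (rhoV c).
Proof. by case: c => [[[] []] [[] []]] [[] []]. Qed.

Lemma rhoVK c : cancel (rhoV c) (rho c).
Proof. by case: c => [[[] []] [[] []]] [[] []]. Qed.

#[global] Arguments rho : simpl never.
#[global] Arguments rhoV : simpl never.

Definition rho_coef (R : realType) (c : knTerm) : R := 12^-1 * (-1) ^+ c.2.2.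

Lemma big_pair (T : Type) (idx : T) (op : Monoid.com_law idx) (I J : finType)
    (F : I * J -> T) :
  \big[op/idx]_z F z = \big[op/idx]_i \big[op/idx]_j F (i, j).
Proof. by rewrite pair_bigA; apply: eq_bigr => -[]. Qed.

Lemma sum_knTerm (R : realType) (F : knTerm -> R) :
  \sum_c F c = \sum_(c1 : bool) \sum_(c2 : bool) \sum_(c3 : bool) \sum_(c4 : bool)
    F ((c1, c2), (c3, c4)).
Proof.
rewrite big_pair big_pair; apply: eq_bigr => c1 _; apply: eq_bigr => c2 _.
exact: big_pair.
Qed.

Section KulkarniSums.
Variables (R : realType) (m : nat) (E : innerProductSpace R m).

Lemma kn_sum (u x : bool * bool -> E) :
  block (kn (u (false, false)) (u (true, false)) (u (false, true)) (u (true, true))) x =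
  \sum_c rho_coef R c * \prod_z ips_form E (u (rho c z)) (x z).
Proof.
rewrite sum_knTerm.
have prodE (F : bool * bool -> R) : \prod_z F z =
    F (false, false) * F (true, false) * F (false, true) * F (true, true).
  by rewrite big_pair !big_bool /=; ring.
rewrite !big_bool !prodE /rho_coef /rho /= expr0 expr1 /block /= /kn_fun; ring.
Qed.

(** Up to sign, eight of the 16 terms equal the value [p] of [A] on the right,
    four a value [q] and four a value [r]. The sum is [8 p + 4 q - 4 r], and
    [q - r = p] by the Bianchi identity; hence the factor 12 in [kn]. *)
Lemma sum_curv (V : vectType R) (A : curvTensor V) (x : bool * bool -> V) :
  \sum_c rho_coef R c * block A (fun z => x (rhoV c z)) = block A x.
Proof.
rewrite sum_knTerm !big_bool /rho_coef /rhoV /= expr0 expr1 /block /=.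
move: (x (false, false)) (x (true, false)) (x (false, true)) (x (true, true)).
move=> {x} x y z w.
have swap a b c d : A b a d c = A a b c d.
  by rewrite curv_anti curv_pair curv_anti opprK curv_pair.
have flip a b c d : A a b d c = - A a b c d by rewrite curv_pair curv_anti curv_pair.
rewrite (flip z w x y) (flip w z y x) (flip y x w z) (flip x y z w).
rewrite (swap z w x y) (swap x y z w) (curv_pair A z w x y).
rewrite (swap x w z y) (swap y w z x) (curv_pair A x w z y) (curv_pair A y w z x).
rewrite (swap z y x w) (swap z x y w).
have -> : A z y x w = A x y z w + A z x y w.
  by rewrite curv_anti; apply/eqP; rewrite eq_sym -subr_eq0 opprK addrAC curv_bianchi.
by field.
Qed.

End KulkarniSums.

(** Ryser's formula. After expansion, the summand of [f] is counted with the
    alternating sum over the sets that contain the image of [f]; it vanishes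
    unless [f] is onto. *)
Lemma sum_sets_prod (R : numDomainType) (n : nat) (a : 'I_n -> 'I_n -> R) :
  \sum_(S : {set 'I_n}) (-1) ^+ #|S| * \prod_k \sum_(q in S) a k q =
  (-1) ^+ n * \sum_(t : {perm 'I_n}) \prod_k a k (t k).
Proof.
pose w (f : {ffun 'I_n -> 'I_n}) : R :=
  \sum_(S : {set 'I_n}) (-1) ^+ #|S| * \prod_k (f k \in S)%:R.
transitivity (\sum_f w f * \prod_k a k (f k)).
  rewrite (eq_bigr (fun S : {set 'I_n} =>
      \sum_(f : {ffun 'I_n -> 'I_n})
        (-1) ^+ #|S| * \prod_k (f k \in S)%:R * \prod_k a k (f k))) => [|S _].
    rewrite exchange_big; apply: eq_bigr => f _ /=.
    by rewrite /w mulr_suml.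
  rewrite (eq_bigr (fun k => \sum_q (q \in S)%:R * a k q)) => [|k _].
    rewrite bigA_distr_bigA mulr_sumr; apply: eq_bigr => f _.
    by rewrite -mulrA -big_split.
  by rewrite big_mkcond; apply: eq_bigr => q _; case: ifP; rewrite ?mul1r ?mul0r.
have w_inj (f : {ffun 'I_n -> 'I_n}) : injective f -> w f = (-1) ^+ n.
  move=> f_inj; rewrite /w (bigD1 setT) //= big1 => [|k _]; last by rewrite inE.
  rewrite mulr1 cardsT card_ord big1 ?addr0 // => S SN.
  have [q qS] : exists q, q \notin S.
    apply/existsP; rewrite -negb_forall; apply: contra SN => /forallP SE.
    by apply/eqP/setP => q; rewrite SE inE.
  by rewrite (bigD1 (invF f_inj q)) //= f_invF (negPf qS) mul0r mulr0.
have w_missing (f : {ffun 'I_n -> 'I_n}) q : (forall k, f k != q) -> w f = 0.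
  move=> fq; pose tog (S : {set 'I_n}) := if q \in S then S :\ q else q |: S.
  have togK : involutive tog.
    move=> S; rewrite /tog; have [qS|qS] := boolP (q \in S).
      by rewrite !inE eqxx /= setD1K.
    by rewrite !inE eqxx /= setU1K.
  suff : w f = - w f.
    move=> /eqP; rewrite -subr_eq0 opprK -mulr2n Num.Theory.mulrn_eq0 /=.
    by move/eqP.
  rewrite {1}/w (reindex_inj (inv_inj togK)) /= /w -sumrN; apply: eq_bigr => S _.
  rewrite -mulNr; congr (_ * _).
    rewrite /tog; have [qS|qS] := boolP (q \in S).
      by rewrite [in RHS](cardsD1 q) qS exprS mulN1r opprK.
    by rewrite cardsU1 qS exprS mulN1r.
  apply: eq_bigr => k _; rewrite /tog.
  by case: ifP; rewrite !inE (negPf (fq k)).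
rewrite (bigID (fun f : {ffun 'I_n -> 'I_n} => injectiveb f)) /= addrC big1 ?add0r.
  rewrite (reindex (@pval _)) /=; last first.
    pose in_Sn := insubd (1%g : {perm 'I_n}).
    by exists in_Sn => /= f Uf; first apply: val_inj; apply: insubdK.
  rewrite mulr_sumr; apply: eq_big => [t|t _]; first by rewrite (valP t).
  rewrite w_inj; last exact/injectiveP/(valP t).
  by congr (_ * _); apply: eq_bigr => k _; rewrite pvalE.
move=> f f_ninj.
have [q /forallP fq] : exists q, [forall k, f k != q].
  apply/existsP; apply: contraR f_ninj; rewrite negb_exists => /forallP f_onto.
  have /fin_all_exists[f' f'K] q : exists k, f k = q.
    have := f_onto q; rewrite negb_forall => /existsP[k].
    by rewrite negbK => /eqP; exists k.
  by apply/injectiveP; apply: can_inj (canF_sym f'K).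
by rewrite (w_missing f q fq) mul0r.
Qed.

Section Polarization.
Variables (R : realType) (l : nat).

Section Space.
Variables (m : nat) (E : innerProductSpace R m).

Section CurvSum.
Variables (S : {set 'I_l}) (A : 'I_l -> curvTensor E).

Definition curv_sum_fun (x y z w : E) : R := \sum_(q in S) A q x y z w.

Fact curv_sum_lin1 y z w : scalar (fun x => curv_sum_fun x y z w).
Proof.
move=> a u v; rewrite /curv_sum_fun mulr_sumr -big_split.
by apply: eq_bigr => q _; rewrite (curv_lin1 (A q)).
Qed.
Fact curv_sum_lin2 x z w : scalar (fun y => curv_sum_fun x y z w).
Proof.
move=> a u v; rewrite /curv_sum_fun mulr_sumr -big_split.
by apply: eq_bigr => q _; rewrite (curv_lin2 (A q)).
Qed.
Fact curv_sum_lin3 x y w : scalar (fun z => curv_sum_fun x y z w).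
Proof.
move=> a u v; rewrite /curv_sum_fun mulr_sumr -big_split.
by apply: eq_bigr => q _; rewrite (curv_lin3 (A q)).
Qed.
Fact curv_sum_lin4 x y z : scalar (fun w => curv_sum_fun x y z w).
Proof.
move=> a u v; rewrite /curv_sum_fun mulr_sumr -big_split.
by apply: eq_bigr => q _; rewrite (curv_lin4 (A q)).
Qed.
Fact curv_sum_anti x y z w : curv_sum_fun x y z w = - curv_sum_fun y x z w.
Proof. by rewrite -sumrN; apply: eq_bigr => q _; apply: curv_anti. Qed.
Fact curv_sum_pair x y z w : curv_sum_fun x y z w = curv_sum_fun z w x y.
Proof. by apply: eq_bigr => q _; apply: curv_pair. Qed.
Fact curv_sum_bianchi x y z w :
  curv_sum_fun x y z w + curv_sum_fun y z x w + curv_sum_fun z x y w = 0.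
Proof. by rewrite -!big_split big1 // => q _; apply: curv_bianchi. Qed.

Definition curv_sum : curvTensor E :=
  CurvTensor curv_sum_lin1 curv_sum_lin2 curv_sum_lin3 curv_sum_lin4
    curv_sum_anti curv_sum_pair curv_sum_bianchi.

End CurvSum.

Definition kn_at (u : slot l -> E) (q : 'I_l) : curvTensor E :=
  let v b a := u (Some (q, b), a) in
  kn (v false false) (v true false) (v false true) (v true true).

(** For [P] homogeneous of degree [l], this is up to a sign the polarization of
    [P] at the tensors [kn_at u q]: the alternating sum keeps the part that is
    linear in each of them. *)
Definition polarized (P : invFamily R m) (u : slot l -> E) : R :=
  \sum_(S : {set 'I_l}) (-1) ^+ #|S| *
    P E (curv_sum S (kn_at u)) (u (None, false)) (u (None, true)).

End Space.

Implicit Types (t : {perm 'I_l}) (f : {ffun 'I_l -> knTerm}).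

(** The slot whose vector is paired with the argument [z] when the product of the
    tensors [kn_at u (t k)] is expanded and [f k] is the term taken from the
    [k]-th factor. *)
Definition kn_slot t f (z : argSlot l) : argSlot l :=
  let c := rho (f z.1.1) (z.1.2, z.2) in ((t z.1.1, c.1), c.2).

Definition kn_slotV t f (z : argSlot l) : argSlot l :=
  let k := (t^-1)%g z.1.1 in
  let c := rhoV (f k) (z.1.2, z.2) in ((k, c.1), c.2).

Lemma kn_slotK t f : cancel (kn_slot t f) (kn_slotV t f).
Proof.
case=> [[k b] a]; case zE: (rho (f k) (b, a)) => [b' a'].
have -> : kn_slot t f (k, b, a) = (t k, b', a') by rewrite /kn_slot [rho _ _]zE.
rewrite /kn_slotV; have z'E : rhoV (f ((t^-1)%g (t k))) (b', a') = (b, a).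
  by rewrite permK -zE rhoK.
by rewrite [rhoV _ _]z'E /= permK.
Qed.

Lemma kn_slotVK t f : cancel (kn_slotV t f) (kn_slot t f).
Proof.
case=> [[k b] a]; set k' := (t^-1)%g k; case zE: (rhoV (f k') (b, a)) => [b' a'].
have -> : kn_slotV t f (k, b, a) = (k', b', a') by rewrite /kn_slotV [rhoV _ _]zE.
rewrite /kn_slot; have z'E : rho (f k') (b', a') = (b, a) by rewrite -zE rhoVK.
by rewrite [rho _ _]z'E /= permKV.
Qed.

Definition lift_slot (h : argSlot l -> argSlot l) (z : slot l) : slot l :=
  if z.1 is Some p then (Some (h (p, z.2)).1, (h (p, z.2)).2) else z.

Lemma lift_slotK h h' : cancel h h' -> cancel (lift_slot h) (lift_slot h').
Proof. by move=> hK [[p|] a] //=; rewrite /lift_slot /= -surjective_pairing hK. Qed.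

Lemma join_lift (V : Type) (w : argSlot l -> V) x y h :
  (fun z => join w x y (lift_slot h z)) = join (fun z => w (h z)) x y.
Proof.
by apply: funext => -[[p|] a] //; rewrite /lift_slot /join /= -surjective_pairing.
Qed.

Definition kn_perm t f : {perm slot l} :=
  perm (can_inj (lift_slotK (kn_slotK t f))).

Definition kn_coef f : R := \prod_k rho_coef R (f k).

Definition polar_coef (d : {perm slot l} -> R) (s : {perm slot l}) : R :=
  (-1) ^+ l * \sum_t \sum_f kn_coef f * d (s * (kn_perm t f)^-1)%g.

Lemma matching_comb_polar d m (E : innerProductSpace R m) (u : slot l -> E) :
  matching_comb (polar_coef d) u = (-1) ^+ l * \sum_t \sum_f kn_coef f *
    matching_comb d (fun z => u (lift_slot (kn_slot t f) z)).
Proof.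
rewrite {1}/matching_comb; under eq_bigr do rewrite /polar_coef -mulrA.
rewrite -mulr_sumr; congr (_ * _).
under eq_bigr do rewrite mulr_suml; rewrite exchange_big; apply: eq_bigr => t _ /=.
under eq_bigr do rewrite mulr_suml; rewrite exchange_big; apply: eq_bigr => f _ /=.
under eq_bigr do rewrite -mulrA; rewrite -mulr_sumr; congr (_ * _).
rewrite (reindex_inj (mulIg (kn_perm t f))); apply: eq_bigr => s _ /=.
rewrite mulgK; congr (_ * _); apply: eq_bigr => p _.
by rewrite !permM !permE.
Qed.

Lemma kn_at_contraction d m (E : innerProductSpace R m) t (u : slot l -> E) :
  \sum_(j : {ffun argSlot l -> 'I_(\dim {:E})})
    curv_prod (fun k => kn_at u (t k)) (fun z => bvec (j z)) *
    matching_comb d (join (fun z => bdual (j z)) (u (None, false)) (u (None, true)))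
  = \sum_f kn_coef f * matching_comb d (fun z => u (lift_slot (kn_slot t f) z)).
Proof.
transitivity (\sum_(j : {ffun argSlot l -> 'I_(\dim {:E})}) \sum_f
    kn_coef f *
    ((\prod_z ips_form E (u (Some (kn_slot t f z).1, (kn_slot t f z).2)) (bvec (j z))) *
    matching_comb d (join (fun z => bdual (j z)) (u (None, false)) (u (None, true))))).
  apply: eq_bigr => j _; under [RHS]eq_bigr do rewrite mulrA.
  rewrite -mulr_suml; congr (_ * _).
  rewrite /curv_prod.
  rewrite (eq_bigr (fun k => \sum_c rho_coef R c *
      \prod_z ips_form E (u (Some (t k, (rho c z).1), (rho c z).2))
                         (bvec (j ((k, z.1), z.2))))); last first.
    by move=> k _; rewrite -(kn_sum (fun z => u (Some (t k, z.1), z.2))).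
  rewrite bigA_distr_bigA; apply: eq_bigr => f _.
  rewrite big_split; congr (_ * _) => /=.
  rewrite big_pair big_pair; apply: eq_bigr => k _ /=.
  rewrite big_pair; apply: eq_bigr => b _ /=; apply: eq_bigr => a _ //.
rewrite exchange_big; apply: eq_bigr => f _ /=; rewrite -mulr_sumr; congr (_ * _).
rewrite -(multilinear_expand
   (fun z i => ips_form E (u (Some (kn_slot t f z).1, (kn_slot t f z).2)) (bvec i)) _
   (join_multilinear d _ _)).
congr matching_comb; apply: funext => -[[p|] []] //=; rewrite /lift_slot /join /=;
  by rewrite [RHS]sum_bdual; apply: eq_bigr => i _; rewrite ips_formC.
Qed.

Lemma polarized_contr d m (E : innerProductSpace R m) (u : slot l -> E) :
  polarized (contr d (m := m)) u = matching_comb (polar_coef d) u.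
Proof.
rewrite matching_comb_polar; under [in RHS]eq_bigr do rewrite -kn_at_contraction.
rewrite [in RHS]exchange_big [RHS]mulr_sumr /polarized /contr.
under eq_bigr do rewrite mulr_sumr.
rewrite [LHS]exchange_big; apply: eq_bigr => j _ /=.
under eq_bigr do rewrite mulrA; rewrite -!mulr_suml mulrA; congr (_ * _).
exact: (sum_sets_prod (fun k q => block (kn_at u q) (fun c => bvec (j ((k, c.1), c.2))))).
Qed.

(** Polarizing an invariant loses nothing, since every curvature tensor is
    contracted from tensors [kn], see [sum_curv]. *)
Lemma contr_polar d m (E : innerProductSpace R m) (A : curvTensor E) (x y : E) :
  contr (polar_coef d) A x y = (-1) ^+ l * l`!%:R * contr d A x y.
Proof.
rewrite /contr; under eq_bigr do rewrite matching_comb_polar mulrCA.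
rewrite -mulr_sumr -mulrA; congr (_ * _).
under eq_bigr do rewrite mulr_sumr; rewrite exchange_big /=.
rewrite (eq_bigr (fun=> contr d A x y)) => [|t _].
  by rewrite sumr_const (card_Sn l) mulr_natl.
under eq_bigr do rewrite mulr_sumr; rewrite exchange_big /=.
transitivity (\sum_f \sum_(j : {ffun argSlot l -> 'I_(\dim {:E})})
    kn_coef f * curv_prod (fun=> A) (fun z => bvec (j (kn_slotV t f z))) *
    matching_comb d (join (fun z => bdual (j z)) x y)).
  apply: eq_bigr => f _.
  rewrite (reindex (fun j : {ffun argSlot l -> 'I_(\dim {:E})} =>
      [ffun z => j (kn_slotV t f z)])) /=; last first.
    exists (fun j => [ffun z => j (kn_slot t f z)]) => j _;
    by apply/ffunP => z; rewrite !ffunE ?kn_slotK ?kn_slotVK.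
  apply: eq_bigr => j _; rewrite mulrCA -mulrA; congr (_ * (_ * _)).
    by congr curv_prod; apply: funext => z; rewrite ffunE.
  rewrite join_lift; congr matching_comb; congr join.
  by apply: funext => z; rewrite ffunE kn_slotK.
rewrite exchange_big; apply: eq_bigr => j _ /=; rewrite -mulr_suml; congr (_ * _).
transitivity (\sum_(f : {ffun 'I_l -> knTerm}) \prod_k
   (rho_coef R (f k) *
    block A (fun z => bvec (j (k, (rhoV (f k) z).1, (rhoV (f k) z).2))))).
  apply: eq_bigr => f _; rewrite big_split; congr (_ * _) => /=.
  rewrite /curv_prod (reindex_inj (@perm_inj _ t)); apply: eq_bigr => k _ /=.
  by congr block; apply: funext => -[b a]; rewrite /kn_slotV !permK.
rewrite -(bigA_distr_bigA (fun k c => rho_coef R c *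
   block A (fun z => bvec (j (k, (rhoV c z).1, (rhoV c z).2))))).
apply: eq_bigr => k _.
exact: (sum_curv A (fun z => bvec (j (k, z.1, z.2)))).
Qed.

End Polarization.

(** * Euclidean space *)

Section Euclid.
Variables (R : realType) (n : nat).

Definition dotp (u v : 'rV[R]_n) : R := \sum_i u 0 i * v 0 i.

Fact dotp_bilinear :
  bilinear_for
    (GRing.Scale.Law.clone _ _ ( *%R ) _)
    (GRing.Scale.Law.clone _ _ (idfun \; *%R ) _) dotp.
Proof.
split=> [v|u] a x y; rewrite /dotp /= mulr_sumr -big_split; apply: eq_bigr => i _;
  by rewrite !mxE /=; ring.
Qed.

HB.instance Definition _ :=
  bilinear_isBilinear.Build R 'rV[R]_n 'rV[R]_n R
    (GRing.Scale.Law.clone _ _ ( *%R ) _)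
    (GRing.Scale.Law.clone _ _ (idfun \; *%R ) _) dotp dotp_bilinear.

Fact dotp_sym (u v : 'rV[R]_n) : dotp u v = (-1) ^+ false * idfun (dotp v u).
Proof.
by rewrite expr0 mul1r /=; apply: eq_bigr => i _; rewrite mulrC.
Qed.

HB.instance Definition _ :=
  isHermitianSesquilinear.Build R 'rV[R]_n false idfun dotp dotp_sym.

Definition dotpS : {symmetric 'rV[R]_n} := dotp.

Lemma dotp_delta (u : 'rV[R]_n) i : dotp u (delta_mx 0 i) = u 0 i.
Proof.
rewrite /dotp (bigD1 i) //= mxE !eqxx mulr1 big1 ?addr0 // => j ji.
by rewrite mxE (negPf ji) andbF mulr0.
Qed.

Fact dotp_nondeg : nondegenerate dotpS.
Proof.
apply/eqP/vspaceP => u; rewrite memv0; apply/idP/eqP => [|->]; last exact: mem0v.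
move=> /mem_orthovP u0; apply/rowP => i.
by rewrite -dotp_delta mxE; apply: u0; apply: memvf.
Qed.

Fact euclid_dim : \dim {:'rV[R]_n} = n.
Proof. by rewrite dimvf /dim /= mul1n. Qed.

Definition euclid : innerProductSpace R n :=
  @InnerProductSpace R n 'rV[R]_n euclid_dim dotpS dotp_nondeg.

Definition evec (i : 'I_n) : euclid := delta_mx 0 i.

Lemma evec_orthonormal i j : ips_form euclid (evec i) (evec j) = (i == j)%:R.
Proof. by rewrite [LHS]dotp_delta mxE eqxx eq_sym. Qed.

End Euclid.

(** * Invariants and their restrictions *)

Section Kernel.
Variables (R : realType) (l : nat).
Local Notation pr := (option (argPair l)).

Lemma card_pr : #|{: pr}| = (2 * l).+1.
Proof. by rewrite card_option card_prod card_ord card_bool mulnC. Qed.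

Lemma kn_at_swap m (E : innerProductSpace R m) (u : slot l -> E) p q :
  kn_at (fun z => u (tperm (p, false) (p, true) z)) q = kn_at u q.
Proof.
pose u' z := u (tperm (p, false) (p, true) z).
have swapE b :
    u' (Some (q, b), false) = u (Some (q, b), false) /\
    u' (Some (q, b), true) = u (Some (q, b), true) \/
    u' (Some (q, b), false) = u (Some (q, b), true) /\
    u' (Some (q, b), true) = u (Some (q, b), false).
  rewrite /u'; have [->|pq] := eqVneq p (Some (q, b)).
    by right; rewrite tpermL tpermR.
  by left; rewrite !tpermD // xpair_eqE (negPf pq).
rewrite -/u'; apply: curvTensor_eq => x y z w; rewrite /= /kn_fun.
by have [[-> ->]|[-> ->]] := swapE false; have [[-> ->]|[-> ->]] := swapE true; ring.
Qed.

Lemma polarized_swap m (P : invFamily R m) (E : innerProductSpace R m)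
    (u : slot l -> E) p :
  (forall (A : curvTensor E) x y, P E A x y = P E A y x) ->
  polarized P (fun z => u (tperm (p, false) (p, true) z)) = polarized P u.
Proof.
move=> P_sym; apply: eq_bigr => S _; congr (_ * _).
have -> : curv_sum S (kn_at (fun z => u (tperm (p, false) (p, true) z))) =
          curv_sum S (kn_at u).
  by congr curv_sum; apply: funext => q; apply: kn_at_swap.
case: p => [p|]; first by rewrite !tpermD.
by rewrite tpermL tpermR P_sym.
Qed.

Lemma matching_comb_polar0 (d : {perm slot l} -> R) m (E : innerProductSpace R m) :
  (forall (A : curvTensor E) x y, contr d A x y = 0) ->
  forall u : slot l -> E, matching_comb (polar_coef d) u = 0.
Proof.
move=> contr0 u; rewrite -polarized_contr /polarized big1 // => S _.
by rewrite contr0 mulr0.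
Qed.

Lemma contr0_colour_val (d : {perm slot l} -> R) :
  (forall chi : slot l -> pr, colour_val (polar_coef d) chi = 0) ->
  forall m (E : innerProductSpace R m) (A : curvTensor E) x y, contr d A x y = 0.
Proof.
move=> val0 m E A x y.
have nz : (-1) ^+ l * l`!%:R != 0 :> R.
  by rewrite mulf_neq0 ?signr_eq0 // Num.Theory.pnatr_eq0 -lt0n fact_gt0.
apply: (mulfI nz); rewrite -contr_polar mulr0 /contr big1 // => j _.
by rewrite (colour_val0_matching_comb0 val0) mulr0.
Qed.

(** In dimension at least [2 * l + 1] there are enough orthonormal vectors to
    tell all matchings apart. *)
Lemma contr0_dim_gt (d : {perm slot l} -> R) n :
  ((2 * l).+1 <= n)%N ->
  (forall (A : curvTensor (euclid R n)) x y, contr d A x y = 0) ->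
  forall m (E : innerProductSpace R m) (A : curvTensor E) x y, contr d A x y = 0.
Proof.
rewrite -card_pr => pr_n contr0; apply: contr0_colour_val => chi.
pose e (p : pr) := evec R (widen_ord pr_n (enum_rank p)).
rewrite -(@matching_comb_orthonormal _ _ _ _ _ _ _ e).
  exact: matching_comb_polar0.
move=> z z'; rewrite evec_orthonormal.
by rewrite -val_eqE /= val_eqE (inj_eq enum_rank_inj).
Qed.

(** Vanishing in dimension [2 * l] makes [colour_val] vanish at the colourings that
    miss a colour; the symmetries of [kn] and of the values of the invariant are
    those that [colour_val_eq0] requires. *)
Lemma contr0_dim_eq (d : {perm slot l} -> R) :
  (forall m (E : innerProductSpace R m) (A : curvTensor E) x y,
     contr d A x y = contr d A y x) ->
  (forall (A : curvTensor (euclid R (2 * l))) x y, contr d A x y = 0) ->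
  colour_val (polar_coef d) (fun z : slot l => z.1) = 0 ->
  forall m (E : innerProductSpace R m) (A : curvTensor E) x y, contr d A x y = 0.
Proof.
move=> sym contr0 val_fst.
pose e := fun p : pr => evec R (cast_ord card_pr (enum_rank p)).
have e_on p q : ips_form (euclid R (2 * l).+1) (e p) (e q) = (p == q)%:R.
  by rewrite evec_orthonormal -val_eqE /= val_eqE (inj_eq enum_rank_inj).
have valE chi : colour_val (polar_coef d) chi =
    polarized (contr d (m := _)) (fun z : slot l => e (chi z)).
  by rewrite polarized_contr (matching_comb_orthonormal (polar_coef d)).
apply: contr0_colour_val; apply: colour_val_eq0 => // [chi p|chi c0 chi_c0].
  by rewrite !valE; apply: (polarized_swap (fun z => e (chi z))); apply: sym.
pose r p := cast_ord card_pr (enum_rank p).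
pose e' p : euclid R (2 * l) := if unlift (r c0) (r p) is Some i then evec R i else 0.
have r_inj : injective r by move=> p q /cast_ord_inj/enum_rank_inj.
rewrite -(@matching_comb_orthonormal _ _ _ _ _ _ _ e'); first exact: matching_comb_polar0.
move=> z z'; rewrite /e'.
have rN u : r c0 != r (chi u) by rewrite (inj_eq r_inj) eq_sym.
have [i zE ->] := unlift_some (rN z); have [i' z'E ->] := unlift_some (rN z').
by rewrite evec_orthonormal -(inj_eq r_inj) zE z'E (inj_eq lift_inj).
Qed.

End Kernel.

(** * The spanning contractions as matchings *)

Lemma big_option (T : Type) (idx : T) (op : Monoid.com_law idx) (I : finType)
    (F : option I -> T) :
  \big[op/idx]_p F p = op (F None) (\big[op/idx]_q F (Some q)).
Proof.
rewrite (bigD1 None) //=; congr (op _ _).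
rewrite (reindex_omap Some id) => [|[]//].
by apply: eq_bigl => q; rewrite /= eqxx.
Qed.

Section Positions.
Variable l : nat.

Fact pair_pos_subproof (p : argPair l) : (2 * p.1 + p.2 < 2 * l)%N.
Proof. by case: p => k b /=; have := ltn_ord k; lia. Qed.

Definition pair_pos (p : argPair l) : 'I_(2 * l) := Ordinal (pair_pos_subproof p).

(** The position of an argument in the product of curvature tensors, and the
    position of the contracted index that corresponds to a slot. *)
Definition eta_pos (z : argSlot l) : 'I_(4 * l) := pos4 z.1.1 (inord (z.1.2 + 2 * z.2)).

Definition contr_pos (z : argSlot l) : 'I_(4 * l) := pos2 (pair_pos z.1) (inord z.2).

Lemma pair_pos_bij : bijective pair_pos.
Proof.
apply: inj_card_bij; last by rewrite card_ord card_prod card_ord card_bool; lia.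
move=> [k b] [k' b'] /(congr1 val) /= kb.
by case: b b' kb => -[] kb; try lia; congr (_, _); apply: val_inj => /=; lia.
Qed.

Lemma card_argSlot : (4 * l <= #|{: argSlot l}|)%N.
Proof. by rewrite !card_prod card_ord card_bool; lia. Qed.

Lemma eta_pos_bij : bijective eta_pos.
Proof.
apply: inj_card_bij; last by rewrite card_ord card_argSlot.
move=> [[k b] a] [[k' b'] a'] /(congr1 val) /=.
rewrite !inordK; try by case: b a b' a' => -[] [] [].
move=> E; have kk : k = k' by apply: val_inj => /=; lia.
by subst k'; case: b a b' a' E => -[] [] [] //=; lia.
Qed.

Lemma contr_pos_bij : bijective contr_pos.
Proof.
apply: inj_card_bij; last by rewrite card_ord card_argSlot.
move=> [p a] [p' a'] /(congr1 val); rewrite /= !inordK; try by case: a a' => -[].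
move=> E; have /(bij_inj pair_pos_bij) <- : pair_pos p = pair_pos p'.
  by apply: val_inj => /=; lia.
by case: a a' E => -[] //=; lia.
Qed.

End Positions.

Local Notation free0 := (None, false).
Local Notation free1 := (None, true).

Section Contractions.
Variables (R : realType) (l : nat).
Implicit Types (s : {perm slot l}) (sigma : 'S_(4 * l)).

Definition matching_contr s (m : nat) : invFamily R m := fun E A x y =>
  \sum_(j : {ffun argSlot l -> 'I_(\dim {:E})})
    curv_prod (fun _ => A) (fun z => bvec (j z)) *
    matching_prod s (join (fun z => bdual (j z)) x y : _ -> E).

Lemma contr_matching (d : {perm slot l} -> R) m (E : innerProductSpace R m)
    (A : curvTensor E) (x y : E) :
  contr d A x y = \sum_s d s * matching_contr s A x y.
Proof.
rewrite /contr /matching_comb; under eq_bigr do rewrite mulr_sumr.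
rewrite exchange_big; apply: eq_bigr => s _ /=; rewrite /matching_contr mulr_sumr.
by apply: eq_bigr => j _; rewrite mulrCA.
Qed.

Lemma matching_contr_paired h s m (E : innerProductSpace R m) (A : curvTensor E)
    (x y : E) :
  paired h -> matching_contr (h * s)%g A x y = matching_contr s A x y.
Proof. by move=> h_pair; apply: eq_bigr => j _; rewrite matching_prod_paired. Qed.

Lemma matching_contr_swap s m (E : innerProductSpace R m) (A : curvTensor E) (x y : E) :
  matching_contr s A y x = matching_contr (s * tperm free0 free1)%g A x y.
Proof.
apply: eq_bigr => j _; congr (_ * _); apply: eq_bigr => p _; rewrite !permM.
have joinE z : join (fun z => bdual (j z)) y x z =
    join (fun z => bdual (j z)) x y (tperm free0 free1 z).
  by case: z => [[q|] []]; rewrite ?tpermL ?tpermR // tpermD.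
by rewrite !joinE.
Qed.

(** Translation between permutations of positions and matchings of slots: the
    free slots are paired with each other, and the arguments as the contracted
    indices of [sigma]. *)
Definition rel_perm sigma s :=
  [/\ s free0 = free0, s free1 = free1 &
      forall z, exists2 z', s (Some z.1, z.2) = (Some z'.1, z'.2) &
        sigma (eta_pos z') = contr_pos z].

Lemma rel_perm_sigma sigma : exists s, rel_perm sigma s.
Proof.
have [eV etaK etaVK] := eta_pos_bij l.
have [cV contrK contrVK] := contr_pos_bij l.
pose t z := eV ((sigma^-1)%g (contr_pos z)).
pose tV z := cV (sigma (eta_pos z)).
have tK : cancel t tV by move=> z; rewrite /tV /t etaVK permKV contrK.
exists (perm (can_inj (lift_slotK tK))); split; rewrite ?permE //.
by case=> p a; exists (t (p, a)); rewrite ?permE // /t etaVK permKV.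
Qed.

Lemma rel_perm_slot s : s free0 = free0 -> s free1 = free1 ->
  exists sigma, rel_perm sigma s.
Proof.
move=> s0 s1.
have s_free a : s (None, a) = (None, a) by case: a.
have /fin_all_exists[t tE] (z : argSlot l) :
    exists t : argSlot l, s (Some z.1, z.2) = (Some t.1, t.2).
  case E: (s _) => [[p|] a]; first by exists (p, a).
  by have := E; rewrite -s_free => /perm_inj.
have t_inj : injective t.
  move=> z z' /eqP; rewrite -pair_eqE /pair_eq => /andP[/eqP e1 /eqP e2].
  have /perm_inj[e3 e4] : s (Some z.1, z.2) = s (Some z'.1, z'.2).
    by rewrite !tE e1 e2.
  by rewrite [z]surjective_pairing e3 e4 -surjective_pairing.
have [eV etaK etaVK] := eta_pos_bij l.
have sig_inj : injective (fun i => contr_pos (invF t_inj (eV i))).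
  have invt_inj := can_inj (f_invF t_inj).
  exact: inj_comp (bij_inj (contr_pos_bij l)) (inj_comp invt_inj (can_inj etaVK)).
exists (perm sig_inj); split=> // z; exists (t z) => //.
by rewrite permE etaK invF_f.
Qed.

(** [eta] reads the indices through [sigma]; the passage from positions to slots
    absorbs it. *)
Lemma sum_index (I : finType) (F : {ffun argSlot l -> I} -> R) sigma :
  \sum_j F j = \sum_(i : {ffun 'I_(4 * l) -> I}) F [ffun z => i (sigma (eta_pos z))].
Proof.
have [eV etaK etaVK] := eta_pos_bij l.
apply: reindex.
exists (fun j : {ffun argSlot l -> I} => [ffun k => j (eV ((sigma^-1)%g k))]).
  by move=> i _; apply/ffunP => k; rewrite !ffunE etaVK permKV.
by move=> j _; apply/ffunP => z; rewrite !ffunE permK etaK.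
Qed.

Lemma curv_prod_eta m (E : innerProductSpace R m) (A : curvTensor E) sigma
    (i : {ffun 'I_(4 * l) -> 'I_(\dim {:E})}) :
  curv_prod (fun _ => A) (fun z => bvec (i (sigma (eta_pos z)))) = eta A (i \o sigma).
Proof. by []. Qed.

Lemma Pcontr2E sigma s m (E : innerProductSpace R m) (A : curvTensor E) (x y : E) :
  rel_perm sigma s -> Pcontr2 sigma A x y = matching_contr s A x y.
Proof.
move=> [s0 s1 s_sigma]; rewrite /matching_contr (sum_index _ sigma) /Pcontr2 mulr_suml.
apply: eq_bigr => i _; rewrite [LHS]mulrC mulrA [LHS]mulrC.
congr (_ * _).
  by rewrite -curv_prod_eta; congr curv_prod; apply: funext => z; rewrite ffunE.
rewrite /matching_prod big_option s0 s1; congr (_ * _).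
rewrite (reindex (@pair_pos l)); last exact: onW_bij (pair_pos_bij l).
apply: eq_bigr => p _; rewrite ginv_bdual.
have [z zE z_pos] := s_sigma (p, false); have [z' z'E z'_pos] := s_sigma (p, true).
by rewrite zE z'E /join /= -!surjective_pairing !ffunE z_pos z'_pos.
Qed.

(** The matching [s] joins the two free slots; exchanging one of them with an
    element of the last pair joins both to the elements of that pair. The
    symmetric product averages over the two orders of [x] and [y]. *)
Lemma Pcontr1E (L : argPair l) sigma s m (E : innerProductSpace R m)
    (A : curvTensor E) (x y : E) :
  (pair_pos L).+1 = (2 * l)%N -> rel_perm sigma s ->
  let s' := (tperm (Some L, true) free1 * s)%g in
  Pcontr1 sigma A x y = 2^-1 * (matching_contr s' A x y + matching_contr s' A y x).
Proof.
move=> L_last [s0 s1 s_sigma] s'.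
rewrite /matching_contr !(sum_index _ sigma) -big_split mulr_sumr.
apply: eq_bigr => i _ /=.
rewrite -mulrDr mulrCA [LHS]mulrC; congr (_ * _).
  by rewrite -curv_prod_eta; congr curv_prod; apply: funext => z; rewrite ffunE.
pose G p := ginv (i (contr_pos (p, false))) (i (contr_pos (p, true))).
pose a := i (contr_pos (L, false)); pose b := i (contr_pos (L, true)).
pose j : {ffun argSlot l -> _} := [ffun z => i (sigma (eta_pos z))].
have gmE u v : matching_prod s' (join (fun z => bdual (j z)) u v : _ -> E) =
    bcovec b u * bcovec a v * \prod_(p | p != L) G p.
  have [z zE z_pos] := s_sigma (L, false); have [z' z'E z'_pos] := s_sigma (L, true).
  rewrite /matching_prod big_option !permM tpermR tpermD // s0 z'E.
  rewrite (bigD1 L) //= !permM tpermL tpermD ?xpair_eqE ?andbF // zE s1.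
  rewrite /join /= -!surjective_pairing !ffunE z_pos z'_pos mulrA.
  rewrite ips_formC !form_bdual; congr (_ * _ * _).
  apply: eq_bigr => p pL.
  have tD q : tperm (Some L, true) free1 (Some p, q) = (Some p, q).
    by rewrite tpermD // xpair_eqE (inj_eq Some_inj) eq_sym (negPf pL).
  rewrite !permM !tD.
  have [w wE w_pos] := s_sigma (p, false); have [w' w'E w'_pos] := s_sigma (p, true).
  by rewrite wE w'E /= -!surjective_pairing !ffunE w_pos w'_pos -ginv_bdual.
rewrite !gmE -mulrDl mulrA (reindex (@pair_pos l)); last exact: onW_bij (pair_pos_bij l).
rewrite (bigD1 L) //= [X in (X < _)%N]L_last ltnn; congr (_ * _).
  by rewrite /symprod -/a -/b; congr (_ * _); rewrite addrC; congr (_ + _); apply: mulrC.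
apply: eq_bigr => p pL; rewrite ifT //.
rewrite -L_last ltnS ltn_neqAle; apply/andP; split.
  apply: contra pL => /eqP pLE; apply/eqP/(bij_inj (pair_pos_bij l)).
  exact: val_inj.
by rewrite -ltnS L_last; apply: (ltn_ord (pair_pos p)).
Qed.

(** The coefficients are the same in all dimensions. *)
Definition isPD (P : forall m, invFamily R m) :=
  exists d1 d2 : 'S_(4 * l) -> R, forall m, fam_eq (P m) (@PD R l m d1 d2).

Lemma isPD_contr1 sigma : isPD (@Pcontr1 R l ^~ sigma).
Proof.
exists (fun t => (t == sigma)%:R), (fun=> 0) => m E A x y.
rewrite /PD (bigD1 sigma) //= eqxx mul1r mul0r addr0 big1 ?addr0 // => t /negPf ->.
by rewrite !mul0r addr0.
Qed.

Lemma isPD_contr2 sigma : isPD (@Pcontr2 R l ^~ sigma).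
Proof.
exists (fun=> 0), (fun t => (t == sigma)%:R) => m E A x y.
rewrite /PD (bigD1 sigma) //= eqxx mul1r mul0r add0r big1 ?addr0 // => t /negPf ->.
by rewrite !mul0r addr0.
Qed.

Lemma isPD_sum (I : finType) (c : I -> R) (P : I -> forall m, invFamily R m) :
  (forall i, isPD (P i)) -> isPD (fun m E A x y => \sum_i c i * P i m E A x y).
Proof.
move=> /fin_all_exists[d1 /fin_all_exists[d2 PE]].
exists (fun t => \sum_i c i * d1 i t), (fun t => \sum_i c i * d2 i t) => m E A x y.
rewrite /PD (eq_bigr _ (fun i _ => congr1 (fun r => c i * r) (PE i m E A x y))).
under eq_bigr do rewrite /PD mulr_sumr.
rewrite exchange_big; apply: eq_bigr => t _ /=.
rewrite !mulr_suml -big_split; apply: eq_bigr => i _ /=; ring.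
Qed.

Lemma isPD_ext (P Q : forall m, invFamily R m) :
  (forall m, fam_eq (P m) (Q m)) -> isPD Q -> isPD P.
Proof.
by move=> PQ [d1 [d2 QE]]; exists d1, d2 => m E A x y; rewrite PQ QE.
Qed.

Lemma PD_contr d1 d2 : (0 < l)%N ->
  exists d : {perm slot l} -> R, forall m, fam_eq (@PD R l m d1 d2) (contr d (m := m)).
Proof.
move=> l_gt0.
have lt_l : (l.-1 < l)%N by rewrite prednK.
pose L : argPair l := (Ordinal lt_l, true).
have L_last : (pair_pos L).+1 = (2 * l)%N by rewrite /=; lia.
have [s s_rel] := fin_all_exists rel_perm_sigma.
pose s' sigma := (tperm (Some L, true) free1 * s sigma)%g.
pose s'' sigma := (s' sigma * tperm free0 free1)%g.
exists (fun t => \sum_sigma (d1 sigma * 2^-1 * (t == s' sigma)%:R +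
   d1 sigma * 2^-1 * (t == s'' sigma)%:R + d2 sigma * (t == s sigma)%:R)) => m E A x y.
have delta (t0 : {perm slot l}) :
    \sum_t (t == t0)%:R * matching_contr t A x y = matching_contr t0 A x y.
  rewrite (bigD1 t0) //= eqxx mul1r big1 ?addr0 // => t /negPf ->.
  by rewrite mul0r.
rewrite contr_matching; under [RHS]eq_bigr do rewrite mulr_suml.
rewrite exchange_big; apply: eq_bigr => sigma _ /=.
under [RHS]eq_bigr do rewrite !mulrDl -!(mulrA _ _ (matching_contr _ _ _ _)).
rewrite !big_split -!mulr_sumr !delta (Pcontr1E _ _ _ L_last (s_rel sigma)).
by rewrite (Pcontr2E _ _ _ (s_rel sigma)) (matching_contr_swap _ A x y) /= mulrDr; ring.
Qed.

Fact pair_move_subproof (pi : {perm option (argPair l)})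
    (e : option (argPair l) -> bool) :
  injective (fun z : slot l => (pi z.1, z.2 (+) e z.1)).
Proof. by move=> [p a] [p' a'] [/perm_inj /= <- /addIb ->]. Qed.

Definition pair_move pi e : {perm slot l} := perm (@pair_move_subproof pi e).

Lemma pair_move_paired pi e : paired (pair_move pi e).
Proof. by apply/forallP => p; rewrite !permE. Qed.

Definition matching_contr_sym s (m : nat) : invFamily R m := fun E A x y =>
  2^-1 * (matching_contr s A x y + matching_contr s A y x).

(** Permuting the pairs and exchanging the elements of a pair bring the slots
    that are matched with the free slots to the places where [Pcontr1] and
    [Pcontr2] expect them. *)
Lemma isPD_matching_contr_sym s : (0 < l)%N -> isPD (matching_contr_sym s).
Proof.
move=> l_gt0.
wlog s0 : s / s free0 = free0 => [IH|].
  pose p := (s^-1)%g free0; pose h := pair_move (tperm None p.1) (fun=> p.2).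
  apply: (isPD_ext _ (IH (h * s)%g _)) => [m E A x y|].
    by rewrite /matching_contr_sym !matching_contr_paired // pair_move_paired.
  by rewrite permM permE /= tpermL -surjective_pairing permKV.
have [s1|s1] := eqVneq (s free1) free1.
  have [sigma s_sigma] := rel_perm_slot s0 s1.
  apply: (isPD_ext _ (isPD_contr2 sigma)) => m E A x y.
  rewrite /matching_contr_sym -!(Pcontr2E _ _ _ s_sigma) /Pcontr2 (ips_formC y x).
  by field.
have lt_l : (l.-1 < l)%N by rewrite prednK.
pose L : argPair l := (Ordinal lt_l, true).
have L_last : (pair_pos L).+1 = (2 * l)%N by rewrite /=; lia.
have [q [a sqE]] : exists q a, s (Some q, a) = free1.
  case E: ((s^-1)%g free1) => [[q|] a]; first by exists q, a; rewrite -E permKV.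
  have : s (None, a) = free1 by rewrite -E permKV.
  by case: a {E} => [/eqP|]; rewrite ?(negPf s1) ?s0.
pose h := pair_move (tperm (Some L) (Some q)) (fun p => (p != None) && ~~ a).
pose s2 := (h * s)%g; pose t := tperm (Some L, true) free1 : {perm slot l}.
have s20 : s2 free0 = free0 by rewrite permM permE /= tpermD.
have s2L : s2 (Some L, true) = free1 by rewrite permM permE /= tpermL negbK.
have [||sigma s_sigma] := @rel_perm_slot (t * s2)%g.
- by rewrite permM tpermD.
- by rewrite permM tpermR.
apply: (isPD_ext _ (isPD_contr1 sigma)) => m E A x y.
rewrite (Pcontr1E _ _ _ L_last s_sigma) mulgA tperm2 mul1g.
by rewrite /matching_contr_sym !matching_contr_paired // pair_move_paired.
Qed.

Lemma isPD_sym (d : {perm slot l} -> R) : (0 < l)%N ->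
  isPD (fun m E A x y => 2^-1 * (contr d (m := m) A x y + contr d A y x)).
Proof.
move=> l_gt0; apply: isPD_ext (isPD_sum d (fun s => isPD_matching_contr_sym s l_gt0)).
move=> m E A x y; rewrite !contr_matching -big_split mulr_sumr; apply: eq_bigr => s _.
by rewrite /matching_contr_sym /=; ring.
Qed.

End Contractions.
(** * The generalized Einstein tensor *)

Section Tinv.
Variables (R : realType) (l : nat).
Local Notation pr := (option (argPair l)).
Local Notation N := (2 * l).+1.

(** The summation index of [Tinv] that belongs to a pair of slots. *)
Definition T_index (p : pr) : 'I_N :=
  if p is Some q then inord (2 * q.1 + q.2) else ord_max.

(** In [Tinv] the last two arguments of each curvature tensor are in reverse
    order. *)
Definition flip_pair (p : pr) : pr := omap (fun q => (q.1, ~~ q.2)) p.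

Lemma flip_pairK : involutive flip_pair.
Proof. by case=> [[k b]|] //=; rewrite negbK. Qed.

Lemma T_index_bij : bijective T_index.
Proof.
apply: inj_card_bij; last by rewrite card_ord card_pr.
have lt_q (q : argPair l) : (2 * q.1 + q.2 < N)%N.
  by have := pair_pos_subproof q; lia.
have val_q (q : argPair l) : T_index (Some q) = (2 * q.1 + q.2)%N :> nat.
  by rewrite inordK.
have Nmax q : T_index (Some q) != T_index None.
  apply/negP => /eqP/(congr1 (@nat_of_ord _)); rewrite val_q /= => E.
  by have := pair_pos_subproof q; lia.
move=> [q|] [q'|] E //; last 2 first.
- by have := Nmax q; rewrite E eqxx.
- by have := Nmax q'; rewrite E eqxx.
congr Some; apply: (bij_inj (pair_pos_bij l)); apply: val_inj => /=.
by rewrite -!val_q E.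
Qed.

Lemma prod_slot (F : slot l -> R) :
  \prod_z F z = F free0 * F free1 * \prod_(z : argSlot l) F (Some z.1, z.2).
Proof.
rewrite [LHS]big_pair big_option [in RHS]big_pair /=; congr (_ * _).
by rewrite big_bool mulrC.
Qed.

(** Expanding the free slots as well brings [contr] to the form of [Tinv], which
    sums over indices for all slots. *)
Lemma contr_free (d : {perm slot l} -> R) m (E : innerProductSpace R m)
    (A : curvTensor E) (x y : E) :
  contr d A x y = \sum_(J : {ffun slot l -> 'I_(\dim {:E})})
    curv_prod (fun _ => A) (fun z => bvec (J (Some z.1, z.2))) *
    (ips_form E (bvec (J free0)) x * ips_form E (bvec (J free1)) y) *
    matching_comb d (fun z => bdual (J z) : E).
Proof.
pose M (j : {ffun argSlot l -> 'I_(\dim {:E})}) (z : slot l) (i : 'I_(\dim {:E})) : R :=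
  if z.1 is Some p then (i == j (p, z.2))%:R
  else ips_form E (bvec i) (if z.2 then y else x).
transitivity (\sum_(j : {ffun argSlot l -> 'I_(\dim {:E})})
    \sum_(J : {ffun slot l -> 'I_(\dim {:E})})
    curv_prod (fun _ => A) (fun z => bvec (j z)) * (\prod_z M j z (J z)) *
    matching_comb d (fun z => bdual (J z) : E)).
  apply: eq_bigr => j _; under [RHS]eq_bigr do rewrite -mulrA.
  rewrite -mulr_sumr; congr (_ * _).
  rewrite -(multilinear_expand (M j) _ (matching_comb_multilinear d)).
  congr matching_comb; apply: funext => -[[p|] b]; rewrite /join /M /=; last first.
    by case: b; apply: sum_bdual.
  rewrite (bigD1 (j (p, b))) //= eqxx scale1r big1 ?addr0 // => i /negPf ->.
  by rewrite scale0r.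
rewrite exchange_big; apply: eq_bigr => J _ /=; rewrite -mulr_suml; congr (_ * _).
pose j0 : {ffun argSlot l -> 'I_(\dim {:E})} := [ffun z => J (Some z.1, z.2)].
rewrite (bigD1 j0) //= [X in _ + X]big1 ?addr0 => [|j jN].
  rewrite (prod_slot (fun z => M j0 z (J z))) /M /= big1 => [|z _].
    rewrite mulr1; congr (_ * _).
    by congr curv_prod; apply: funext => z; rewrite ffunE.
  by rewrite ffunE /= eqxx.
have [z zN] : exists z, j0 z != j z.
  apply/existsP; rewrite -negb_forall; apply: contra jN => /forallP jE.
  by apply/eqP/ffunP => z; apply/esym/eqP.
have zN' : J (Some z.1, z.2) != j (z.1, z.2).
  by rewrite -surjective_pairing; rewrite ffunE in zN.
rewrite (prod_slot (fun z => M j z (J z))) (bigD1 z) //= /M /= (negPf zN').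
by rewrite !mul0r !mulr0.
Qed.

(** The inverse of [T_index]. *)
Variables (T_pair : 'I_N -> pr) (T_indexK : cancel T_index T_pair).
Variable T_pairK : cancel T_pair T_index.

Fact T_slot_subproof (pi : 'S_N) : injective (fun z : slot l =>
  if z.2 then (flip_pair (T_pair (pi (T_index z.1))), true) else z).
Proof.
move=> [p []] [p' []] //= [].
by move=> /(inv_inj flip_pairK)/(can_inj T_pairK)/perm_inj/(can_inj T_indexK) ->.
Qed.

Definition T_slot pi : {perm slot l} := perm (@T_slot_subproof pi).

(** The expansion of a determinant whose rows are the first and whose columns
    are the second elements of the pairs, see [matching_comb_T_coef]. *)
Definition T_coef (s : {perm slot l}) : R :=
  \sum_(pi : 'S_N) (-1) ^+ pi * (s == T_slot pi)%:R.

Lemma matching_comb_T_coef m (E : innerProductSpace R m) (v : slot l -> E) :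
  matching_comb T_coef v = \det (\matrix_(a, b)
    ips_form E (v (T_pair a, false)) (v (flip_pair (T_pair b), true))).
Proof.
rewrite /matching_comb /T_coef /determinant; under eq_bigr do rewrite mulr_suml.
rewrite exchange_big; apply: eq_bigr => pi _ /=.
rewrite (bigD1 (T_slot pi)) //= eqxx mulr1 big1 ?addr0 => [|s /negPf ->]; last first.
  by rewrite mulr0 mul0r.
congr (_ * _); rewrite /matching_prod (reindex T_index); last exact: onW_bij T_index_bij.
by apply: eq_bigr => p _; rewrite !permE mxE /= T_indexK.
Qed.

Lemma TinvE m (E : innerProductSpace R m) (A : curvTensor E) (x y : E) :
  Tinv l A x y = 2^-1 * (contr T_coef A x y + contr T_coef A y x).
Proof.
rewrite !contr_free -big_split mulr_sumr /Tinv pair_bigA /=.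
pose h (J : {ffun slot l -> 'I_(\dim {:E})}) :
    {ffun 'I_N -> 'I_(\dim {:E})} * {ffun 'I_N -> 'I_(\dim {:E})} :=
  ([ffun a => J (T_pair a, false)], [ffun b => J (flip_pair (T_pair b), true)]).
rewrite (reindex h) /=; last first.
  exists (fun ij : {ffun 'I_N -> 'I_(\dim {:E})} * {ffun 'I_N -> 'I_(\dim {:E})} =>
    [ffun z : slot l =>
       if z.2 then ij.2 (T_index (flip_pair z.1)) else ij.1 (T_index z.1)]).
    by move=> J _; apply/ffunP => -[p []]; rewrite !ffunE /= T_indexK ?flip_pairK.
  move=> [i j] _; congr (_, _); apply/ffunP => a; rewrite !ffunE /= ?flip_pairK;
    by rewrite T_pairK.
apply: eq_bigr => J _.
have T_last : T_pair ord_max = None by rewrite -[ord_max]/(T_index None) T_indexK.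
have hE1 p : [ffun a => J (T_pair a, false)] (T_index p) = J (p, false).
  by rewrite ffunE T_indexK.
have hE2 p :
    [ffun a => J (flip_pair (T_pair a), true)] (T_index p) = J (flip_pair p, true).
  by rewrite ffunE T_indexK.
rewrite [in X in _ * X](_ : ord_max = T_index None) // hE1 hE2.
rewrite [X in _ * X * _](_ : _ =
  matching_comb T_coef (fun z => bdual (J z) : E)); last first.
  rewrite matching_comb_T_coef; congr determinant; apply/matrixP => a b.
  by rewrite !mxE !ffunE ginv_bdual.
rewrite [X in X * _ * _](_ : _ =
  curv_prod (fun=> A) (fun z => bvec (J (Some z.1, z.2)))); last first.
  apply: eq_bigr => k _.
  have E0 : inord (2 * k) = T_index (Some (k, false)) by rewrite /= addn0.
  have E1 : inord (2 * k).+1 = T_index (Some (k, true)) by rewrite /= addn1.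
  by rewrite E0 E1 !hE1 !hE2.
by rewrite /symprod /flat; ring.
Qed.

End Tinv.

#[global] Arguments T_index {l} p.
Section TinvKernel.
Variables (R : realType) (l : nat).
Local Notation pr := (option (argPair l)).
Local Notation N := (2 * l).+1.

Lemma Tinv_sym m (E : innerProductSpace R m) (A : curvTensor E) (x y : E) :
  Tinv l A x y = Tinv l A y x.
Proof.
have [T_pair T_indexK T_pairK] := T_index_bij l.
by rewrite !(TinvE T_indexK T_pairK) addrC.
Qed.

Lemma isPD_Tinv : (0 < l)%N -> isPD l (@Tinv R l).
Proof.
move=> l_gt0; have [T_pair T_indexK T_pairK] := T_index_bij l.
apply: isPD_ext (isPD_sym (T_coef R T_indexK T_pairK) l_gt0) => m E A x y.
exact: TinvE.
Qed.

(** There are more rows than values for their indices. *)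
Lemma Tinv_dim0 (E : innerProductSpace R (2 * l)) (A : curvTensor E) (x y : E) :
  Tinv l A x y = 0.
Proof.
rewrite /Tinv big1 // => i _; rewrite big1 // => j _.
have /injectivePn[a [b ab iab]] : ~~ injectiveb i.
  apply/negP => /injectiveP/leq_card.
  by rewrite !card_ord ips_dim ltnn.
by rewrite (determinant_alternate ab) ?mulr0 ?mul0r // => c; rewrite !mxE iab.
Qed.

(** Exchanging the elements of a pair, for the pairs selected by [f]. *)
Definition flip_perm (f : 'I_l -> bool) : 'S_N :=
  (\prod_k (if f k then tperm (T_index (Some (k, false))) (T_index (Some (k, true)))
            else 1))%g.

Lemma flip_permE f p : flip_perm f (T_index p) =
  T_index (omap (fun q : argPair l => (q.1, q.2 (+) f q.1)) p).
Proof.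
have T_inj := bij_inj (T_index_bij l).
pose sw k : 'S_N := if f k then tperm (T_index (Some (k, false)))
                                      (T_index (Some (k, true))) else 1%g.
rewrite -[flip_perm f]/(\prod_k sw k)%g; case: p => [[k0 b]|]; last first.
  apply: (big_ind (fun s : 'S_N => s (T_index None) = T_index None)) => [|s t sE tE|k _].
  - by rewrite perm1.
  - by rewrite permM sE tE.
  - by rewrite /sw; case: ifP; rewrite ?perm1 // tpermD // (inj_eq T_inj).
suff E r : uniq r -> (\prod_(k <- r) sw k)%g (T_index (Some (k0, b)))
    = T_index (Some (k0, b (+) ((k0 \in r) && f k0))).
  by rewrite E ?index_enum_uniq // mem_index_enum.
elim: r b => [|k r IHr] b /=; first by rewrite big_nil perm1 addbF.
move=> /andP[kr r_uniq]; rewrite big_cons permM inE.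
have [k0E|k0k] := eqVneq k0 k.
  subst k; have -> : sw k0 (T_index (Some (k0, b))) = T_index (Some (k0, b (+) f k0)).
    by rewrite /sw; case: (f k0); case: b; rewrite ?perm1 ?tpermL ?tpermR.
  by rewrite IHr // (negPf kr) /= addbF.
have -> : sw k (T_index (Some (k0, b))) = T_index (Some (k0, b)); last exact: IHr.
have k0N c : T_index (Some (k, c)) != T_index (Some (k0, b)).
  by rewrite (inj_eq T_inj) (inj_eq Some_inj) xpair_eqE negb_and eq_sym k0k.
by rewrite /sw; case: (f k); rewrite ?perm1 ?tpermD.
Qed.

Lemma sign_flip_perm f : (-1) ^+ flip_perm f = \prod_k (-1) ^+ f k :> R.
Proof.
rewrite /flip_perm (big_morph _ (@odd_permM _) (@odd_perm1 _)).
have sign0 : (-1) ^+ false = 1 :> R by rewrite expr0.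
rewrite (big_morph (fun b : bool => (-1) ^+ b : R) (@signr_addb R) sign0).
apply: eq_bigr => k _.
case: (f k); last by rewrite odd_perm1.
by rewrite odd_tperm (inj_eq (bij_inj (T_index_bij l))) (inj_eq Some_inj) xpair_eqE andbF.
Qed.

Variables (T_pair : 'I_N -> pr) (T_indexK : cancel T_index T_pair).
Variable T_pairK : cancel T_pair T_index.

(** At orthonormal vectors that are equal within each pair, the 16 terms of each
    [kn] contribute equally, the sign of a term being that of the permutation of
    the columns of the determinant. *)
Lemma matching_comb_T_coef_kn m (E : innerProductSpace R m) (e : pr -> E)
    (t : {perm 'I_l}) (f : {ffun 'I_l -> knTerm}) :
  (forall p q, ips_form E (e p) (e q) = (p == q)%:R) ->
  kn_coef R f * matching_comb (T_coef R T_indexK T_pairK)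
    (fun z => e (lift_slot (kn_slot t f) z).1) = (- 12^-1) ^+ l.
Proof.
move=> e_on; rewrite matching_comb_T_coef.
pose g k := ~~ (f k).2.2.
rewrite (_ : \matrix_(a, b) _ = perm_mx (flip_perm g)).
  rewrite det_perm sign_flip_perm /kn_coef -big_split /=.
  rewrite (eq_bigr (fun=> - 12^-1)) ?prodr_const ?card_ord // => k _.
  by rewrite /rho_coef /g; case: (_.2.2); rewrite /= ?expr0 ?expr1; ring.
pose theta (p : pr) : pr := omap (fun q : argPair l => (t q.1, q.2 (+) (f q.1).2.1)) p.
have theta_inj : injective theta.
  move=> [[k b]|] [[k' b']|] //= [] /perm_inj <- /addIb -> //.
apply/matrixP => a b; rewrite !mxE e_on; congr (_ %:R).
have fst0 p : (lift_slot (kn_slot t f) (p, false)).1 = theta p.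
  case: p => [[k c]|] //=; rewrite /lift_slot /kn_slot /rho /=.
  by rewrite addbF.
have fst1 p : (lift_slot (kn_slot t f) (p, true)).1 =
    theta (omap (fun q : argPair l => (q.1, q.2 (+) ~~ g q.1)) p).
  case: p => [[k c]|] //=; rewrite /lift_slot /kn_slot /rho /g /=.
  by rewrite negbK.
rewrite fst0 fst1 (inj_eq theta_inj) -{2}[a]T_pairK flip_permE.
rewrite -(inj_eq (can_inj T_pairK) _ b) T_indexK.
case: (T_pair a) (T_pair b) => [[k c]|] [[k' c']|] //=.
rewrite !(inj_eq Some_inj) !xpair_eqE /=; case: eqP => //= <-.
by case: (g k) c c' => -[] [].
Qed.

Lemma polarized_Tinv_neq0 m (E : innerProductSpace R m) (e : pr -> E) :
  (forall p q, ips_form E (e p) (e q) = (p == q)%:R) ->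
  polarized (Tinv l (m := m)) (fun z : slot l => e z.1) != 0.
Proof.
move=> e_on.
have -> : polarized (Tinv l (m := m)) (fun z : slot l => e z.1) =
    polarized (contr (T_coef R T_indexK T_pairK) (m := m)) (fun z : slot l => e z.1).
  apply: eq_bigr => S _; congr (_ * _); rewrite (TinvE T_indexK T_pairK) /=.
  by field.
rewrite polarized_contr matching_comb_polar mulf_neq0 ?signr_eq0 //.
under eq_bigr do under eq_bigr do rewrite (matching_comb_T_coef_kn _ _ e_on).
rewrite !sumr_const !Num.Theory.mulrn_eq0 !negb_or -!lt0n.
apply/and3P; split; last by rewrite expf_neq0 // oppr_eq0 invr_eq0 Num.Theory.pnatr_eq0.
  by apply/card_gt0P; exists 1%g.
by apply/card_gt0P; exists [ffun=> ((true, true), (true, true))].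
Qed.

End TinvKernel.

Theorem theorem1p8 (R : realType) (l : nat) (l_ge1 : (1 <= l)%N) (s : bool) :
  (forall n : nat,
     (forall P : invFamily R n.+1, inJ l P -> inJ l (restr s P)) /\
     (forall Q : invFamily R n, inJ l Q ->
        exists2 P : invFamily R n.+1, inJ l P & fam_eq (restr s P) Q)) /\
  (forall n : nat, (2 * l + 1 < n.+1)%N ->
     forall P Q : invFamily R n.+1, inJ l P -> inJ l Q ->
       fam_eq (restr s P) (restr s Q) -> fam_eq P Q) /\
  (forall n : nat, n.+1 = (2 * l + 1)%N ->
     forall P : invFamily R n.+1,
       (inJ l P /\ fam_eq (restr s P) (@fam0 R n)) <->
       (exists c : R, fam_eq P (fam_scale c (@Tinv R l n.+1)))).
Proof.
(* Restriction keeps the coefficients [d1] and [d2]. *)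
have restr_PD n d1 d2 : fam_eq (restr s (@PD R l n.+1 d1 d2)) (@PD R l n d1 d2).
  have [d dE] := PD_contr d1 d2 l_ge1 => E A x y.
  by rewrite /restr dE [RHS]dE -[RHS](restr_contr d s).
have restr_eq n (P Q : invFamily R n.+1) : fam_eq P Q -> fam_eq (restr s P) (restr s Q).
  by move=> PQ E A x y; apply: PQ.
split; [|split].
- move=> n; split=> [P [d1 [d2 PE]]|Q [d1 [d2 QE]]].
    by exists d1, d2 => E A x y; rewrite (restr_eq _ _ _ PE) restr_PD.
  exists (PD d1 d2); first by exists d1, d2.
  by move=> E A x y; rewrite restr_PD QE.
- move=> n n_gt P Q [p1 [p2 PE]] [q1 [q2 QE]] PQ.
  have [p pE] := PD_contr p1 p2 l_ge1; have [q qE] := PD_contr q1 q2 l_ge1.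
  have contr0 : forall m (E : innerProductSpace R m) (A : curvTensor E) x y,
      contr (fun t => p t + (-1) * q t) A x y = 0.
    apply: (@contr0_dim_gt _ _ _ n) => [|A x y]; first by rewrite -addn1 -ltnS.
    rewrite contr_lin -(restr_contr p s) -(restr_contr q s) mulN1r; apply/eqP.
    rewrite subr_eq0; apply/eqP; have := PQ (euclid R n) A x y.
    by rewrite /restr PE QE pE qE.
  move=> E A x y; rewrite PE QE pE qE; apply/eqP; rewrite -subr_eq0 -mulN1r.
  by rewrite -contr_lin contr0.
move=> n; rewrite addn1 => -[->] P; split=> [[[p1 [p2 PE]] P0]|[c PE]]; last first.
  have [t1 [t2 TE]] := isPD_Tinv R l_ge1.
  split.
    exists (fun t => c * t1 t), (fun t => c * t2 t) => E A x y.
    rewrite PE /fam_scale TE /PD mulr_sumr; apply: eq_bigr => t _; ring.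
  move=> E A x y; transitivity (c * restr s (PD t1 t2) A x y).
    by rewrite /restr PE /fam_scale TE.
  by rewrite restr_PD -TE Tinv_dim0 mulr0.
have [p pE] := PD_contr p1 p2 l_ge1.
have [t1 [t2 TE]] := isPD_Tinv R l_ge1; have [t tE] := PD_contr t1 t2 l_ge1.
pose e (q : option (argPair l)) := evec R (cast_ord (card_pr l) (enum_rank q)).
have e_on q q' : ips_form (euclid R (2 * l).+1) (e q) (e q') = (q == q')%:R.
  by rewrite evec_orthonormal -val_eqE /= val_eqE (inj_eq enum_rank_inj).
pose u (z : slot l) := e z.1.
have {}TE m (E : innerProductSpace R m) (A : curvTensor E) x y :
  Tinv l A x y = contr t A x y by rewrite TE tE.
have p_sym m (E : innerProductSpace R m) (A : curvTensor E) x y :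
  contr p A x y = contr p A y x by rewrite -!pE; apply: inJ_sym; exists p1, p2.
have [T_pair T_indexK T_pairK] := T_index_bij l.
have T_neq0 := polarized_Tinv_neq0 T_indexK T_pairK e_on.
(* With this [c], the invariant [P - c Tinv] vanishes at the colouring in which
   every pair is monochromatic. *)
pose c := polarized (contr p (m := _)) u / polarized (Tinv l (m := _)) u.
have contr0 : forall m (E : innerProductSpace R m) (A : curvTensor E) x y,
    contr (fun r => p r + (- c) * t r) A x y = 0.
  apply: contr0_dim_eq => [m E A x y|A x y|].
  - by rewrite !contr_lin p_sym -!TE Tinv_sym.
  - rewrite contr_lin -TE Tinv_dim0 mulr0 addr0 -(restr_contr p s) /restr -pE -PE.
    exact: P0.
  rewrite -(@matching_comb_orthonormal _ _ _ _ _ _ _ e) // -polarized_contr.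
  rewrite (_ : polarized _ _ =
    polarized (contr p (m := _)) u - c * polarized (Tinv l (m := _)) u).
    by rewrite /c divfK ?subrr.
  rewrite /polarized mulr_sumr -sumrB; apply: eq_bigr => S _.
  by rewrite contr_lin TE mulrDr mulNr mulrN mulrCA.
exists c => E A x y; rewrite PE pE /fam_scale TE; apply/eqP.
by rewrite -subr_eq0 -mulNr -contr_lin contr0.
Qed.
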